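(* For every integer $n\geq0$, the indexed Jones polynomial $V_K^n(t)$ is a virtual knot invariant, i.e. it is unchanged under all generalized Reidemeister moves.
   Context: Virtual knot diagrams, real crossings with writhe $w(c)\in\{\pm1\}$, $w(K)=\sum_c w(c)$, generalized Reidemeister moves ($\Omega_1,\Omega_2,\Omega_3$, the purely virtual moves, and the mixed move $\Omega_3^v$). Chord index: in the Gauss diagram (counterclockwise circle, one chord per real crossing directed from over- to under-preimage and signed by the writhe), for a chord $c$ let $r_\pm(c)$ (resp. $l_\pm(c)$) be the number of chords of sign $\pm$ whose endpoints interlace with those of $c$ and whose tail lies to the left (resp. right) of the arrow $c$ and head to the right (resp. left); $\mathrm{Ind}(c)=r_+(c)-r_-(c)-l_+(c)+l_-(c)$. For $n\geq 0$ let $C_n(K)=\{c \text{ real crossing}: \mathrm{Ind}(c)=kn \text{ for some } k\in\mathbb{Z}\}$ (so $C_0(K)$ is the set of index-zero crossings and $C_1(K)$ is all real crossings). A state $S$ is obtained by smoothing every crossing of $C_n(K)$ by either the $0$-smoothing ($A$-smoothing of the Kauffman bracket) or the $1$-smoothing ($B$-smoothing), leaving all other crossings (real and virtual) unchanged; $S$ is a virtual link diagram with $|S|$ components, and $\#_0,\#_1$ count the $0$- and $1$-smoothings used. Define $\langle K\rangle_n=\sum_S A^{\#_0-\#_1}(-A^2-A^{-2})^{|S|-1}$ and $V_K^n(t)=(-A^3)^{-w(K)}\langle K\rangle_n\big|_{A=t^{-1/4}}$. *)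

(* Defs.v *)
(* Virtual knots are modelled by signed Gauss diagrams
   (Gauss words). *)
From HB Require Import structures.
From mathcomp Require Import all_boot all_order all_algebra.
Set Implicit Arguments. Unset Strict Implicit. Unset Printing Implicit Defensive.
Import Order.TTheory GRing.Theory Num.Theory.

(* A letter of a Gauss word: ((label of the real crossing, over?), sign)
   sign = true means writhe +1, false means writhe -1. *)
Definition letter := ((nat * bool) * bool)%type.
Definition lab (l : letter) : nat := l.1.1.
Definition ovr (l : letter) : bool := l.1.2.
Definition sgn (l : letter) : bool := l.2.

(* A signed Gauss word: the preimages of the real crossings read in order
   along the oriented knot (= counterclockwise around the Gauss circle,
   position 0, 1, ..., size-1, cyclically). *)
Definition gword := seq letter.

Definition gd_wf (D : gword) : bool :=
  uniq [seq (lab l, ovr l) | l <- D] &&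
  all (fun l => ((lab l, ~~ ovr l), sgn l) \in D) D.

Definition labels (D : gword) : seq nat := undup [seq lab l | l <- D].

Definition tailpos (D : gword) (x : nat) : nat :=
  find (fun l => (lab l == x) && ovr l) D.
Definition headpos (D : gword) (x : nat) : nat :=
  find (fun l => (lab l == x) && ~~ ovr l) D.
Definition sgnof (D : gword) (x : nat) : bool :=
  sgn (nth ((0%N, true), true) D (tailpos D x)).
Definition wsign (b : bool) : int := if b then 1%R else (-1)%R.

Definition writhe (D : gword) : int :=
  \sum_(x <- labels D) wsign (sgnof D x).

(* p lies (strictly) on the right of the arrow t -> h, i.e. on the arc
   going counterclockwise from the tail t to the head h *)
Definition inR (t h p : nat) : bool :=
  if t < h then (t < p) && (p < h) else (t < p) || (p < h).

(* chord index Ind(c) = r_+ - r_- - l_+ + l_- *)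
Definition ind (D : gword) (x : nat) : int :=
  let t := tailpos D x in let h := headpos D x in
  \sum_(y <- labels D)
    (let ty := tailpos D y in let hy := headpos D y in
     if ~~ inR t h ty && inR t h hy then wsign (sgnof D y)
     else if inR t h ty && ~~ inR t h hy then - wsign (sgnof D y)
     else 0)%R.

Definition Cn (n : nat) (D : gword) : seq nat :=
  [seq x <- labels D | (n%:Z %| ind D x)%Z].

(* a state: a 0/1 choice (false = 0-smoothing = A, true = 1-smoothing = B)
   for each crossing of C_n(K) *)
Definition state (n : nat) (D : gword) := {ffun 'I_(size (Cn n D)) -> bool}.

Definition stlist n D (st : state n D) : seq bool :=
  [seq st i | i <- enum 'I_(size (Cn n D))].

(* None = crossing left unchanged; Some b = smoothed with b *)
Definition smode n D (st : state n D) (x : nat) : option bool :=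
  if x \in Cn n D then Some (nth false (stlist st) (index x (Cn n D)))
  else None.

(* arcs: arc i goes from position i to position i+1 (mod N).
   At crossing x with over position a and under position b:
   - unchanged: arc a-1 -- arc a, arc b-1 -- arc b
   - oriented smoothing: arc a-1 -- arc b, arc b-1 -- arc a
   - unoriented smoothing: arc a-1 -- arc b-1, arc a -- arc b.
   The 0-smoothing (A-smoothing) is the oriented one at a positive
   crossing and the unoriented one at a negative crossing. *)
Definition prevpos (N p : nat) : nat := (p + N - 1) %% N.

Definition linked n D (st : state n D) (x i j : nat) : bool :=
  let N := size D in
  let a := tailpos D x in let b := headpos D x in
  let pa := prevpos N a in let pb := prevpos N b in
  match smode st x with
  | None => ((i == pa) && (j == a)) || ((i == pb) && (j == b))
  | Some s =>
      if addb (sgnof D x) s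
      then ((i == pa) && (j == b)) || ((i == pb) && (j == a))
      else ((i == pa) && (j == pb)) || ((i == a) && (j == b))
  end.

Definition arc_rel n D (st : state n D) : rel 'I_(size D) :=
  fun i j => has (fun x => linked st x i j || linked st x j i) (labels D).

Definition ncomp n D (st : state n D) : nat :=
  if size D == 0 then 1
  else #|[set i : 'I_(size D) |
          [forall j : 'I_(size D), connect (arc_rel st) i j ==> (i <= j)]]|.

Local Open Scope ring_scope.

Definition bracket (R : fieldType) (A : R) (n : nat) (D : gword) : R :=
  \sum_(st : state n D)
    A ^ ((count negb (stlist st))%:Z - (count id (stlist st))%:Z) *
    (- A ^+ 2 - A ^- 2) ^+ (ncomp st).-1.

(* V_K^n(t) as a function of q = t^(1/4), i.e. with A = q^-1 = t^(-1/4) *)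
Definition Vjones (R : fieldType) (n : nat) (D : gword) (q : R) : R :=
  let A := q^-1 in (- A ^+ 3) ^ (- writhe D) * bracket A n D.

Definition fresh (D : gword) (x : nat) : bool := x \notin [seq lab l | l <- D].

Definition omega1 (D D' : gword) : Prop :=
  exists (u v : gword) (x : nat) (o s : bool),
    fresh (u ++ v) x /\ D = u ++ v /\
    D' = u ++ [:: (x, o, s); (x, ~~ o, s)] ++ v.

(* Omega_2: insertion of two chords of opposite signs, both going from
   one pair of adjacent positions (over strand) to another (under strand);
   the order in the under pair is the same (parallel strands) or reversed
   (antiparallel strands). *)
Definition omega2 (D D' : gword) : Prop :=
  exists (u v t : gword) (x y : nat) (s rev2 first_over : bool),
    x != y /\ fresh (u ++ v ++ t) x /\ fresh (u ++ v ++ t) y /\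
    D = u ++ v ++ t /\
    let P := [:: (x, true, s); (y, true, ~~ s)] in
    let Q := if rev2 then [:: (y, false, ~~ s); (x, false, s)]
             else [:: (x, false, s); (y, false, ~~ s)] in
    D' = u ++ (if first_over then P else Q) ++ v ++
         (if first_over then Q else P) ++ t.

(* Omega_3: three strands 1 (top), 2 (middle), 3 (bottom), crossings
   a = c_12, b = c_13, c = c_23 with signs p12 p13 p23.  f_i says whether,
   along strand i, the crossing with the lower-numbered other strand comes
   first.  Realizability by three oriented lines in the plane is exactly
   p12+f1+f2 = p23+f2+f3 = p13+f1+f3 (mod 2).  The move reverses the order
   of the two endpoints in each of the three segments. *)
Definition omega3_segs (X Y Z : gword) : Prop :=
  exists (a b c : nat) (p12 p13 p23 f1 f2 f3 : bool),
    addb p12 (addb f1 f2) = addb p23 (addb f2 f3) /\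
    addb p12 (addb f1 f2) = addb p13 (addb f1 f3) /\
    let S1 := if f1 then [:: (a, true, p12); (b, true, p13)]
              else [:: (b, true, p13); (a, true, p12)] in
    let S2 := if f2 then [:: (a, false, p12); (c, true, p23)]
              else [:: (c, true, p23); (a, false, p12)] in
    let S3 := if f3 then [:: (b, false, p13); (c, false, p23)]
              else [:: (c, false, p23); (b, false, p13)] in
    perm_eq [:: X; Y; Z] [:: S1; S2; S3].

Definition omega3 (D D' : gword) : Prop :=
  exists (u1 u2 u3 u4 X Y Z : gword),
    omega3_segs X Y Z /\
    D = u1 ++ X ++ u2 ++ Y ++ u3 ++ Z ++ u4 /\
    D' = u1 ++ rev X ++ u2 ++ rev Y ++ u3 ++ rev Z ++ u4.

(* trivial changes of presentation (same Gauss diagram): choice of the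
   base point and names of the crossings *)
Definition rotation (D D' : gword) : Prop := exists k, D' = rot k D.
Definition relabel (D D' : gword) : Prop :=
  exists f : nat -> nat, injective f /\
    D' = [seq ((f (lab l), ovr l), sgn l) | l <- D].

Definition rstep (D D' : gword) : Prop :=
  omega1 D D' \/ omega2 D D' \/ omega3 D D' \/ rotation D D' \/ relabel D D'.

(* one generalized Reidemeister move (in either direction); purely virtual
   moves and the mixed move do not change the Gauss diagram *)
Definition rmove (D D' : gword) : Prop := rstep D D' \/ rstep D' D.

(* Main.v *)
(* Colour the arcs of a state with two colours, a colour being constant along
   each component: a state with k components has 2^k colourings, and in these
   terms cutting an arc out of a tangle, renumbering arcs or inserting letters in
   a Gauss word are easy. The bracket is thereby rewritten as a recursive state
   sum over crossings, each given only by the positions of its two letters.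

   The index of a chord is the difference of two prefix sums of signed letters
   (plus its sign). Hence the index of every old chord is unchanged by a move,
   the chord of an Omega_1 move has index 0, the two chords of an Omega_2 move
   have equal indices, and in an Omega_3 move ind(c_13) = ind(c_12) + ind(c_23),
   so that the number of smoothed crossings of the triangle is 0, 1 or 3.

   It remains to compare state sums of small tangles. Eliminating the inner arcs
   of each state leaves a matching of the end points and some closed loops, and
   the identities become identities between Laurent polynomials in A attached to
   the matchings, which are checked by computation. *)
Require Import Defs.
From mathcomp Require Import all_boot all_order all_algebra.
From mathcomp Require Import zify ring.
Set Implicit Arguments. Unset Strict Implicit. Unset Printing Implicit Defensive.
Import Order.TTheory GRing.Theory Num.Theory.

(** * Counting components by colourings *)

(** The two sides of a move are always compared on one set of arcs. For Omega_1 and Omega_2 the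
    smaller word is rewritten on the arcs of the larger one, with the new crossings present but left
    alone: such a crossing only joins consecutive arcs of each strand, so it subdivides old arcs
    without changing the number of components. Every Omega move then replaces a short list of
    crossings by another list on the same arcs. The rest of the diagram is summed first and enters
    the local comparison only as an arbitrary function [X] of the matching left by the tangle. An
    identity valid for all [X] is an equality of coefficients matching by matching, and it can be
    verified once, on small arc codes, independently of the diagram. The definition of C_n by
    divisibility is what excludes exactly two smoothed crossings in a triangle: the multiples of
    [n], including the case [n = 0], are closed under sums and differences. *)

Definition edge := (nat * nat)%type.

Definition compat N (E : seq edge) (f : {ffun 'I_N.+1 -> bool}) : bool :=
  all (fun e => f (inord e.1) == f (inord e.2)) E.

Definition ncol N (E : seq edge) : nat := #|[pred f | @compat N E f]|.

(** Relations between numbers of components follow from equality or doubling of [ncol]; the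
    truncated logarithm makes this possible before [ncol] is known to be a power of two. *)
Definition comps N (E : seq edge) : nat := trunc_log 2 (ncol N E).

Lemma compat_cat N E1 E2 f :
  @compat N (E1 ++ E2) f = compat E1 f && compat E2 f.
Proof. exact: all_cat. Qed.

Lemma eq_comps N E E' : (forall f, @compat N E f = compat E' f) ->
  comps N E = comps N E'.
Proof. by move=> eqE; congr trunc_log; apply: eq_card => f; rewrite !inE. Qed.

Lemma ncol_gt1 N E : 1 < ncol N E.
Proof.
rewrite /ncol; have <- : #|[set [ffun=> true]; [ffun=> false] : {ffun 'I_N.+1 -> bool}]| = 2.
  rewrite cards2; case: eqP => // /ffunP /(_ ord0); by rewrite !ffunE.
apply: subset_leq_card; apply/subsetP => f; rewrite !inE.
by case/orP=> /eqP ->; apply/allP => e _; rewrite !ffunE.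
Qed.

Lemma comps_gt0 N E : 0 < comps N E.
Proof. by rewrite trunc_log_gt0 /= ncol_gt1. Qed.

Lemma comps_double N N' E E' : ncol N E = (ncol N' E').*2 ->
  comps N E = (comps N' E').+1.
Proof. by rewrite /comps => ->; rewrite trunc_log2_double // ltnW // ncol_gt1. Qed.

(** Only the colourings have to correspond. The maps invert each other up to arcs that compatible
    colourings cannot tell apart, so arc sets of different sizes can be compared. *)
Lemma ncol_transfer N N' E E'
    (phi : 'I_N'.+1 -> 'I_N.+1) (psi : 'I_N.+1 -> 'I_N'.+1) :
  (forall f i, compat E f -> f (phi (psi i)) = f i) ->
  (forall f i, compat E' f -> f (psi (phi i)) = f i) ->
  (forall f, compat E f -> compat E' [ffun i => f (phi i)]) ->
  (forall f, compat E' f -> compat E [ffun i => f (psi i)]) ->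
  ncol N E = ncol N' E'.
Proof.
move=> hK hK' hE hE'.
pose g (f : {ffun 'I_N.+1 -> bool}) := [ffun i => f (phi i)].
have g_inj : {in [pred f | compat E f] &, injective g}.
  move=> f1 f2; rewrite !inE => f1E f2E /ffunP eqg; apply/ffunP => i.
  by have := eqg (psi i); rewrite !ffunE !hK.
rewrite /ncol -(card_in_image g_inj); apply: eq_card => f; rewrite inE.
apply/imageP/idP => [[f0 f0E ->]|fE]; first exact: hE.
exists [ffun i => f (psi i)]; first exact: hE'.
by apply/ffunP => i; rewrite !ffunE hK'.
Qed.

Section MinRoots.
Variables (n : nat) (e : rel 'I_n.+1).
Hypothesis e_sym : symmetric e.

Let minset := [set i : 'I_n.+1 | [forall j, connect e i j ==> (i <= j)]].
Let mroot i : 'I_n.+1 := [arg min_(j < i | connect e i j) j].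

(** An invariant colouring is a free choice of colour at the least element of each class, and these
    least elements are what [ncomp] counts. *)
Lemma card_invariant_colourings :
  #|[pred g : {ffun 'I_n.+1 -> bool} |
      [forall i, forall j, e i j ==> (g i == g j)]]| = 2 ^ #|minset|.
Proof.
have csym : connect_sym e by apply: sym_connect_sym.
have mrootC i : connect e i (mroot i).
  by rewrite /mroot; case: arg_minnP.
have mroot_min i j : connect e i j -> mroot i <= j.
  by move=> ij; rewrite /mroot; case: arg_minnP => // k _ /(_ _ ij).
have mrootP i : mroot i \in minset.
  rewrite inE; apply/forallP => j; apply/implyP => ij.
  by apply: mroot_min; apply: connect_trans ij.
have mroot_id i : i \in minset -> mroot i = i.
  rewrite inE => /forallP /(_ (mroot i)) /implyP /(_ (mrootC i)) le1.
  by apply/val_inj/eqP; rewrite eqn_leq le1 andbT mroot_min.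
have mroot_eq i j : connect e i j -> mroot i = mroot j.
  move=> ij; apply/val_inj/eqP; rewrite eqn_leq.
  rewrite !mroot_min //; last first.
    by apply: connect_trans (mrootC j).
  by apply: connect_trans (mrootC i); rewrite csym.
pose inv (g : {ffun 'I_n.+1 -> bool}) := [forall i, forall j, e i j ==> (g i == g j)].
have invC (g : {ffun 'I_n.+1 -> bool}) i j : inv g -> connect e i j -> g i = g j.
  move=> ginv /connectP[p].
  elim: p i => [|k p IH] i /=; first by move=> _ ->.
  case/andP=> ik pk jE; rewrite -(IH k pk jE).
  by move/forallP/(_ i)/forallP/(_ k)/implyP/(_ ik)/eqP: ginv.
rewrite -card_powerset.
pose F (g : {ffun 'I_n.+1 -> bool}) := [set i in minset | g i].
have F_inj : {in [pred g | inv g] &, injective F}.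
  move=> g1 g2; rewrite !inE => i1 i2 /setP eqF; apply/ffunP => i.
  have := eqF (mroot i); rewrite !inE.
  have := mrootP i; rewrite inE => -> /=.
  by rewrite -!(invC _ _ _ _ (mrootC i)).
rewrite -(card_in_imset F_inj); apply: eq_card => B.
rewrite powersetE; apply/imsetP/subsetP => [[g _ ->] i|sB].
  by rewrite inE => /andP[].
exists [ffun i => mroot i \in B].
  rewrite inE; apply/forallP => i; apply/forallP => j; apply/implyP => ij.
  by rewrite !ffunE (mroot_eq _ _ (connect1 ij)).
apply/setP => i; rewrite in_set ffunE.
have [iM|iM] := boolP (i \in minset); first by rewrite mroot_id.
by apply/negbTE; apply: contra iM; apply: sB.
Qed.

End MinRoots.

(* Half of the colourings of a graph give a vertex untouched by its edges the
   colour of a prescribed other vertex. *)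
Lemma ncol_pendant N (E : seq edge) (m v : nat) :
  m <= N -> v <= N -> m != v ->
  all (fun e => (inord e.1 != inord m :> 'I_N.+1) && (inord e.2 != inord m :> 'I_N.+1)) E ->
  ncol N E = (ncol N ((m, v) :: E)).*2.
Proof.
move=> mN vN mv mE.
pose mo : 'I_N.+1 := inord m; pose vo : 'I_N.+1 := inord v.
pose flip (f : {ffun 'I_N.+1 -> bool}) := [ffun i => if i == mo then ~~ f i else f i].
have flipK : involutive flip.
  by move=> f; apply/ffunP => i; rewrite !ffunE; case: eqP => // _; rewrite negbK.
have compat_flip f : compat E (flip f) = compat E f.
  apply: eq_in_all => e /(allP mE) /andP[/negbTE e1 /negbTE e2].
  by rewrite !ffunE e1 e2.
rewrite /ncol -(cardID [pred f : {ffun 'I_N.+1 -> bool} | f mo == f vo]) -addnn.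
congr (_ + _); first by apply: eq_card => f; rewrite !inE andbC.
rewrite -(card_image (inv_inj flipK)); apply: eq_card => f; rewrite !inE.
have vm : (vo == mo) = false.
  apply/negbTE; apply: contra mv => /eqP /(congr1 val) /=.
  by rewrite !inordK // => ->.
have mem_flip (P : pred {ffun 'I_N.+1 -> bool}) : (f \in image flip P) = P (flip f).
  apply/imageP/idP => [[g Pg ->]|Pf]; first by rewrite flipK.
  by exists (flip f); rewrite ?flipK.
rewrite mem_flip /= !inE compat_flip !ffunE eqxx vm /=.
by rewrite -/mo -/vo; case: (f mo); case: (f vo).
Qed.

(** * Elimination of arcs *)

(* A crossing [(k, (t, h))] has its over-passage from arc [t] to [t.+1] and its
   under-passage from [h] to [h.+1]; [k = None] when the crossing is left alone
   and [k = Some s] when it is smoothed and has sign [s]. *)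
Definition crossing := (option bool * (nat * nat))%type.

(* [Some true] is the oriented smoothing, [Some false] the unoriented one. *)
Definition smoothing (k : option bool) (p : nat * nat) : seq edge :=
  match k with
  | None => [:: (p.1, p.1.+1); (p.2, p.2.+1)]
  | Some true => [:: (p.1, p.2.+1); (p.2, p.1.+1)]
  | Some false => [:: (p.1, p.2); (p.1.+1, p.2.+1)]
  end.

Definition emb (rho : nat -> nat) (L : seq edge) : seq edge :=
  [seq (rho e.1, rho e.2) | e <- L].

Definition touches (m : nat) (e : edge) := (e.1 == m) || (e.2 == m).
Definition other (m : nat) (e : edge) := if e.1 == m then e.2 else e.1.

(* Removes the arc [m] from a tangle, then hangs it on the arc [0]; the second
   component counts the closed loop formed by [m] alone, if any. *)
Definition elim_arc (m : nat) (L : seq edge) : seq edge * nat :=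
  let U := [seq e <- L | ~~ touches m e] in
  match [seq e <- L | touches m e] with
  | [:: e] =>
      if (e.1 == m) && (e.2 == m) then ((m, 0) :: U, 1) else (L, 0)
  | [:: e1; e2] =>
      if (other m e1 == m) || (other m e2 == m) then (L, 0)
      else ((m, 0) :: (other m e1, other m e2) :: U, 0)
  | _ => (L, 0)
  end.

Fixpoint elim_arcs (ms : seq nat) (L : seq edge) : seq edge * nat :=
  if ms is m :: ms' then
    let Ll := elim_arc m L in
    let Ll' := elim_arcs ms' Ll.1 in (Ll'.1, Ll'.2 + Ll.2)
  else (L, 0).

Definition edge_le (e e' : edge) :=
  (e.1 < e'.1) || (e.1 == e'.1) && (e.2 <= e'.2).
(** A normal form: states inducing the same matching must produce literally the same [X M] before
    coefficients are collected. *)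
Definition normal_tangle (L : seq edge) : seq edge :=
  sort edge_le [seq if e.1 <= e.2 then e else (e.2, e.1) | e <- L].

Section Elimination.
Variables (N : nat) (rho : nat -> nat) (C : seq nat) (E : seq edge).
Hypothesis C0 : 0 \in C.
Hypothesis rho_le : forall c, c \in C -> rho c <= N.

(** [rho] need not be injective, since the last arc of one strand may be the first arc of another.
    Only the eliminated arc must have a unique code and be missed by [E], so that all edges at it
    are visible in the tangle. *)
Definition inner (m : nat) : bool :=
  [&& m \in C, m != 0,
      all (fun c => (c != m) ==> (rho c != rho m)) C &
      all (fun e => [&& e.1 <= N, e.2 <= N, e.1 != rho m & e.2 != rho m]) E].

Definition over_codes (L : seq edge) :=
  all (fun e => (e.1 \in C) && (e.2 \in C)) L.

Lemma inord_neq a b : a <= N -> b <= N -> a != b -> inord a != inord b :> 'I_N.+1.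
Proof.
move=> aN bN; apply: contra => /eqP /(congr1 val) /=.
by rewrite !inordK // => ->.
Qed.

Lemma inner_untouched m L : inner m -> over_codes L ->
  all (fun e => ~~ touches m e) L ->
  all (fun e => (inord e.1 != inord (rho m) :> 'I_N.+1) &&
                (inord e.2 != inord (rho m) :> 'I_N.+1)) (emb rho L ++ E).
Proof.
case/and4P=> mC m0 /allP mrho /allP mE /allP LC /allP LU.
rewrite all_cat; apply/andP; split; apply/allP => e.
  case/mapP=> e' e'L -> /=.
  have := LU _ e'L; rewrite negb_or => /andP[n1 n2].
  have /andP[c1 c2] := LC _ e'L.
  have /implyP/(_ n1) r1 := mrho _ c1; have /implyP/(_ n2) r2 := mrho _ c2.
  by rewrite !inord_neq ?rho_le.
by move/mE => /and4P[? ? ? ?]; rewrite !inord_neq ?rho_le.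
Qed.

Lemma elim_arc_over m L : inner m -> over_codes L -> over_codes (elim_arc m L).1.
Proof.
case/and4P=> mC _ _ _ LC; rewrite /elim_arc.
have UC P : over_codes (filter P L).
  by apply/allP => e; rewrite mem_filter => /andP[_ /(allP LC)].
have := UC (touches m).
case: (filter (touches m) L) => [|e1 [|e2 [|e3 T]]] //=.
  by case: ifP => //= _ _; rewrite mC C0 UC.
case: ifP => //= _; rewrite mC C0 UC /other !andbT /=.
by case/andP=> /andP[? ?] /andP[? ?]; do 2!case: ifP => _; apply/andP.
Qed.

Lemma compat_split (P : pred edge) L f :
  @compat N (emb rho L ++ E) f =
  compat (emb rho (filter P L)) f &&
  compat (emb rho (filter (predC P) L) ++ E) f.
Proof.
rewrite !compat_cat andbA; congr andb; rewrite -compat_cat /emb -map_cat.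
by apply: esym; apply: perm_all; apply: perm_map; rewrite perm_filterC.
Qed.

(** The vertex set is fixed, so an eliminated arc cannot disappear; hung on the arc [0] it
    contributes no component of its own. *)
Lemma elim_arcE m L : inner m -> over_codes L ->
  comps N (emb rho L ++ E) =
  comps N (emb rho (elim_arc m L).1 ++ E) + (elim_arc m L).2.
Proof.
move=> im LC; have /and4P[mC m0 /allP mrho mE] := im.
have split_f f : @compat N (emb rho L ++ E) f = _ := compat_split (touches m) L f.
rewrite /elim_arc; set U := [seq e <- L | ~~ touches m e].
have UC : over_codes U.
  by apply/allP => e; rewrite mem_filter => /andP[_ /(allP LC)].
have Um : all (fun e => ~~ touches m e) U by apply: filter_all.
have r0m : rho m != rho 0.
  by rewrite eq_sym; have /implyP -> := mrho 0 C0; rewrite // eq_sym.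
have TC : over_codes (filter (touches m) L).
  by apply/allP => e; rewrite mem_filter => /andP[_ /(allP LC)].
have Tm : all (touches m) (filter (touches m) L) by apply: filter_all.
case TE: (filter (touches m) L) TC Tm split_f => [|e1 [|e2 [|e3 T]]] TC Tm split_f;
  rewrite ?addn0 //.
  case: ifP => [/andP[/eqP e11 /eqP e12]|_]; last by rewrite addn0.
  rewrite addn1; apply: comps_double.
  rewrite -(@ncol_pendant N _ (rho m) (rho 0)) ?rho_le ?inner_untouched //.
  apply: eq_card => f; rewrite !inE split_f -/U /= e11 e12 eqxx.
  by [].
case: ifP => [_|/norP[o1 o2]]; rewrite addn0 //.
have oC : (other m e1 \in C) && (other m e2 \in C).
  move: TC; rewrite /other /= => /and3P[/andP[? ?] /andP[? ?] _].
  by do 2!case: ifP => _; apply/andP.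
have /andP[oC1 oC2] := oC.
pose U' := (other m e1, other m e2) :: U.
have U'm : all (fun e => ~~ touches m e) U'.
  by rewrite /= Um andbT /touches /= negb_or o1 o2.
have U'C : over_codes U' by rewrite /= oC1 oC2.
(* After doubling, both counts are colourings with [m] free, and a free [m] may be hung on [0] or on
   a former neighbour with the same result. *)
congr trunc_log; apply: double_inj.
rewrite -(@ncol_pendant N (emb rho U' ++ E) (rho m) (rho 0)) ?rho_le ?inner_untouched //.
have o1m : rho m != rho (other m e1).
  by rewrite eq_sym; have /implyP -> := mrho _ oC1.
rewrite (@ncol_pendant N (emb rho U' ++ E) (rho m) (rho (other m e1))) ?rho_le ?inner_untouched //.
congr _.*2; apply: eq_card => f; rewrite !inE split_f -/U /= andbT -!andbA.
rewrite !andbA; congr andb.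
have edgeE e : touches m e ->
    (f (inord (rho e.1)) == f (inord (rho e.2))) =
    (f (inord (rho m)) == f (inord (rho (other m e)))).
  rewrite /touches /other; case: eqP => [-> //|_] /= /eqP ->.
  by rewrite eq_sym.
move: Tm => /= /and3P[t1 t2 _]; rewrite !edgeE //.
by case: (f (inord (rho m))); do 2!case: (f _).
Qed.

Lemma elim_arcsE ms L : all inner ms -> over_codes L ->
  comps N (emb rho L ++ E) =
  comps N (emb rho (elim_arcs ms L).1 ++ E) + (elim_arcs ms L).2.
Proof.
elim: ms L => [|m ms IH] L /=; first by rewrite addn0.
case/andP=> im ims LC; rewrite (elim_arcE im LC) (IH _ ims) ?elim_arc_over //.
by rewrite addnA.
Qed.

Lemma normal_tangleE L :
  comps N (emb rho (normal_tangle L) ++ E) = comps N (emb rho L ++ E).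
Proof.
apply: eq_comps => f; rewrite !compat_cat; congr andb.
rewrite /compat /emb !all_map all_sort all_map; apply: eq_all => e /=.
by case: ifP => //= _; rewrite eq_sym.
Qed.

End Elimination.

Local Open Scope ring_scope.

(** * State sums *)

(* [/=] would unfold [smoothing] on the left of [++]. *)
Opaque smoothing.

Section StateSum.
Variables (R : fieldType) (A : R).
Let d : R := - A ^+ 2 - A ^- 2.

(** The A-smoothing is the oriented one exactly at a positive crossing, so it is [Some s] and the
    B-smoothing is [Some (~~ s)]. *)
Fixpoint state_sum (F : seq edge -> R) (cs : seq crossing) (E : seq edge) : R :=
  if cs is c :: cs' then
    match c.1 with
    | None => state_sum F cs' (smoothing None c.2 ++ E)
    | Some s => A * state_sum F cs' (smoothing (Some s) c.2 ++ E) +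
                A^-1 * state_sum F cs' (smoothing (Some (~~ s)) c.2 ++ E)
    end
  else F E.

Definition loop_value (N : nat) (E : seq edge) : R := d ^+ (comps N E).-1.

Lemma state_sum_cat F cs1 cs2 E :
  state_sum F (cs1 ++ cs2) E = state_sum (state_sum F cs2) cs1 E.
Proof.
by elim: cs1 E => //= -[[s|] p] cs IH E /=; rewrite !IH.
Qed.

(* [I] is an invariant relating the edges accumulated on both sides. *)
Lemma state_sum_rel (I : seq edge -> seq edge -> Prop) (g : crossing -> crossing)
    (a : R) (F F' : seq edge -> R) (cs : seq crossing) (E E' : seq edge) :
  (forall E E', I E E' -> F' E' = a * F E) ->
  (forall c, c \in cs -> (g c).1 = c.1) ->
  (forall c k E E', c \in cs -> I E E' ->
     I (smoothing k c.2 ++ E) (smoothing k (g c).2 ++ E')) ->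
  I E E' -> state_sum F' (map g cs) E' = a * state_sum F cs E.
Proof.
move=> hF; elim: cs E E' => [|c cs IH] E E' g1 hI IE /=; first exact: hF.
have IH' k : state_sum F' (map g cs) (smoothing k (g c).2 ++ E') =
             a * state_sum F cs (smoothing k c.2 ++ E).
  apply: IH => [c' c'cs|c' k' E1 E1' c'cs|]; first by rewrite g1 // inE c'cs orbT.
    by apply: hI; rewrite inE c'cs orbT.
  by apply: hI; rewrite // inE eqxx.
rewrite g1 ?inE ?eqxx //; case: c.1 => [s|]; rewrite !IH' //.
by rewrite mulrDr !mulrA ![a * _]mulrC.
Qed.

Definition perm_invariant (F : seq edge -> R) :=
  forall E E', perm_eq E E' -> F E = F E'.

Lemma loop_value_perm N : perm_invariant (loop_value N).
Proof.
move=> E E' pE; rewrite /loop_value; congr (_ ^+ _.-1).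
by apply: eq_comps => f; apply: perm_all.
Qed.

Lemma state_sum_edges_perm F cs : perm_invariant F -> perm_invariant (state_sum F cs).
Proof.
move=> pF E E' pE.
rewrite -[RHS]mul1r -[cs in LHS]map_id; apply: (@state_sum_rel (fun E E' => perm_eq E' E)) => //.
- by move=> E1 E1' pE1; rewrite mul1r (pF _ _ pE1).
- by move=> c k E1 E1' _; rewrite perm_cat2l.
Qed.

(** This allows the crossings of a move to be brought together, whatever order [labels] lists them
    in. *)
Lemma state_sum_perm F cs cs' : perm_invariant F -> perm_eq cs cs' ->
  state_sum F cs =1 state_sum F cs'.
Proof.
move=> pF; have front x s t E : state_sum F (s ++ x :: t) E = state_sum F (x :: s ++ t) E.
  elim: s E => [|y s IH] E //=.
  pose G k k' := state_sum F (s ++ t) (smoothing k x.2 ++ smoothing k' y.2 ++ E).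
  have GE k k' :
      state_sum F (s ++ t) (smoothing k' y.2 ++ smoothing k x.2 ++ E) = G k k'.
    by apply: state_sum_edges_perm => //; rewrite perm_catCA.
  by case: y.1 => [s2|]; rewrite !IH /=; case: x.1 => [s1|]; rewrite !GE /G; ring.
elim: cs cs' => [|x cs IH] cs' pcs E.
  by move: pcs; rewrite perm_sym => /perm_nilP ->.
have xcs' : x \in cs' by rewrite -(perm_mem pcs) mem_head.
case/path.splitPr: xcs' pcs => s t pcs; rewrite front /=.
have {}pcs : perm_eq cs (s ++ t).
  by rewrite -(perm_cons x) (perm_trans pcs) // perm_catC /= perm_cons perm_catC.
by case: x.1 => [?|]; rewrite !(IH _ pcs).
Qed.

(** The tangle as a linear combination of matchings of its end points; [X] stands for the unknown
    value of the outside on each matching. *)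
Fixpoint tangle_sum (X : seq edge -> R) (ms : seq nat) (cs : seq crossing)
    (L : seq edge) : R :=
  if cs is c :: cs' then
    match c.1 with
    | None => tangle_sum X ms cs' (smoothing None c.2 ++ L)
    | Some s => A * tangle_sum X ms cs' (smoothing (Some s) c.2 ++ L) +
                A^-1 * tangle_sum X ms cs' (smoothing (Some (~~ s)) c.2 ++ L)
    end
  else let Ll := elim_arcs ms L in d ^+ Ll.2 * X (normal_tangle Ll.1).

Definition emb_crossing (rho : nat -> nat) (c : crossing) : crossing :=
  (c.1, (rho c.2.1, rho c.2.2)).

Transparent smoothing.

Lemma state_sum_tangle N rho C E ms cs L :
  0%N \in C -> {in C, forall c, (rho c <= N)%N} ->
  all (inner N rho C E) ms -> over_codes C L ->
  all (fun c => [&& c.2.1 \in C, c.2.1.+1 \in C, c.2.2 \in C, c.2.2.+1 \in C,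
         rho c.2.1.+1 == (rho c.2.1).+1 & rho c.2.2.+1 == (rho c.2.2).+1]) cs ->
  state_sum (loop_value N) (map (emb_crossing rho) cs) (emb rho L ++ E) =
  tangle_sum (fun M => loop_value N (emb rho M ++ E)) ms cs L.
Proof.
move=> C0 rho_le ims; elim: cs L => [|[k [t h]] cs IH] L LC /=.
  rewrite /loop_value (elim_arcsE C0 rho_le ims LC) normal_tangleE => _.
  rewrite -exprD; congr (_ ^+ _).
  (* The exponent is the number of components minus one in [nat]; loops add to it only because at
     least one component is left after the elimination. *)
  have := comps_gt0 N (emb rho (elim_arcs ms L).1 ++ E); lia.
case/andP=> /and5P[tC t1C hC h1C /andP[/eqP rt /eqP rh]] csC.
have step k' : state_sum (loop_value N) (map (emb_crossing rho) cs)
      (smoothing k' (rho t, rho h) ++ emb rho L ++ E) =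
    tangle_sum (fun M => loop_value N (emb rho M ++ E)) ms cs
      (smoothing k' (t, h) ++ L).
  rewrite -IH //; last first.
    rewrite /over_codes all_cat -!/(over_codes _ _) LC andbT.
    by case: k' => [[]|]; rewrite /over_codes /smoothing /= tC t1C hC h1C.
  rewrite catA; congr (state_sum _ _ (_ ++ _)).
  by rewrite /emb map_cat; case: k' => [[]|]; rewrite /smoothing /= ?rt ?rh.
case: k => [s|]; last exact: (step None).
by move: (step (Some s)) (step (Some (~~ s))) => /= -> ->.
Qed.

End StateSum.

(** * Identities for the kink, the poke and the triangle *)

Section TangleIdentities.
Variables (R : fieldType) (A : R) (X : seq edge -> R).
Hypothesis A0 : A != 0.

(* One term [((i, j), l, M)] for each state, standing for
   [A ^+ i * A ^- j * (- A ^+ 2 - A ^- 2) ^+ l * X M]. *)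
Fixpoint tangle_terms (ms : seq nat) (cs : seq crossing) (ij : nat * nat)
    (L : seq edge) : seq ((nat * nat) * nat * seq edge) :=
  if cs is c :: cs' then
    match c.1 with
    | None => tangle_terms ms cs' ij (smoothing None c.2 ++ L)
    | Some s =>
        tangle_terms ms cs' (ij.1.+1, ij.2) (smoothing (Some s) c.2 ++ L) ++
        tangle_terms ms cs' (ij.1, ij.2.+1) (smoothing (Some (~~ s)) c.2 ++ L)
    end
  else let Ll := elim_arcs ms L in [:: (ij, Ll.2, normal_tangle Ll.1)].

Definition eval_terms (ts : seq ((nat * nat) * nat * seq edge)) : R :=
  foldr (fun t r => A ^+ t.1.1.1 * A^-1 ^+ t.1.1.2 *
                    (- A ^+ 2 - A ^- 2) ^+ t.1.2 * X t.2 + r) 0 ts.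

Lemma eval_terms_cat ts ts' : eval_terms (ts ++ ts') = eval_terms ts + eval_terms ts'.
Proof. by elim: ts => [|t ts IH] /=; rewrite ?add0r // IH addrA. Qed.

Lemma tangle_termsE ms cs ij L :
  eval_terms (tangle_terms ms cs ij L) =
  A ^+ ij.1 * A^-1 ^+ ij.2 * tangle_sum A X ms cs L.
Proof.
elim: cs ij L => [|[[s|] p] cs IH] ij L.
- by rewrite /= addr0 !mulrA.
- by rewrite [tangle_terms _ _ _ _]/= eval_terms_cat !IH /= !exprS; ring.
- exact: IH.
Qed.

Lemma tangle_sumE ms cs L :
  tangle_sum A X ms cs L = eval_terms (tangle_terms ms cs (0, 0)%N L).
Proof. by rewrite tangle_termsE !expr0 !mul1r. Qed.

(** Evaluation is confined to lists and natural exponents. Each [X M] then becomes an unknown, and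
    [field] compares the coefficients. *)
Ltac tangle_identity :=
  rewrite !tangle_sumE;
  repeat match goal with |- context [tangle_terms ?ms ?cs ?ij ?L] =>
    let ts := constr:(tangle_terms ms cs ij L) in
    let ts' := eval vm_compute in ts in
    let E := fresh in
    have E : ts = ts' by [vm_compute];
    rewrite E; clear E
  end;
  rewrite /eval_terms /=;
  repeat match goal with |- context [X ?M] => generalize (X M) => ? end;
  try (field; exact: A0).

(** One smoothing splits off a circle and the other straightens the strand. With [d = - A^2 - A^-2]
    the factor is [A * d + A^-1 = - A^3] at a positive kink and [A + A^-1 * d = - A^-3] at a
    negative one. *)
Lemma tangle_sum_kink (s : bool) (p : nat * nat) :
  p \in [:: (0, 1); (1, 0)]%N ->
  tangle_sum A X [:: 1%N] [:: (Some s, p)] [::] =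
  (- A ^+ 3) ^ (wsign s) * tangle_sum A X [:: 1%N] [:: (None, p)] [::].
Proof.
have -> : (- A ^+ 3) ^ (wsign s) = if s then - A ^+ 3 else - A^-1 ^+ 3.
  by case: s; rewrite /= ?expr1z // exprN1 invrN exprVn.
by rewrite !inE; case: s; case/orP=> /eqP ->; tangle_identity.
Qed.

(** One of the four states lets both strands pass, with coefficient [1]. The three others share a
    single matching, with total coefficient [A^2 + A^-2 + d = 0]. *)
Lemma tangle_sum_poke (s rev2 : bool) :
  tangle_sum A X [:: 1; 4]%N
    [:: (Some s, (0, if rev2 then 4 else 3)%N);
        (Some (~~ s), (1, if rev2 then 3 else 4)%N)] [::] =
  tangle_sum A X [:: 1; 4]%N
    [:: (None, (0, if rev2 then 4 else 3)%N);
        (None, (1, if rev2 then 3 else 4)%N)] [::].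
Proof. by case: s; case: rev2; tangle_identity. Qed.

Definition kind (smoothed s : bool) : option bool := if smoothed then Some s else None.

(* The three strands carry the arcs [0 1 2], [3 4 5] and [6 7 8]. *)
Definition triangle (ka kb kc p12 p13 p23 f1 f2 f3 : bool) : seq crossing :=
  [:: (kind ka p12, (if f1 then 0 else 1, if f2 then 3 else 4)%N);
      (kind kb p13, (if f1 then 1 else 0, if f3 then 6 else 7)%N);
      (kind kc p23, (if f2 then 4 else 3, if f3 then 7 else 6)%N)].

(** With one smoothed crossing, each of its smoothings gives the same matching on both sides; with
    three, this is the invariance of the Kauffman bracket under Omega_3. *)
Lemma tangle_sum_triangle (ka kb kc p12 p13 p23 f1 f2 f3 : bool) :
  (ka && kb ==> kc) && (ka && kc ==> kb) && (kb && kc ==> ka) ->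
  p12 (+) (f1 (+) f2) = p23 (+) (f2 (+) f3) ->
  p12 (+) (f1 (+) f2) = p13 (+) (f1 (+) f3) ->
  tangle_sum A X [:: 1; 4; 7]%N (triangle ka kb kc p12 p13 p23 f1 f2 f3) [::] =
  tangle_sum A X [:: 1; 4; 7]%N
    (triangle ka kb kc p12 p13 p23 (~~ f1) (~~ f2) (~~ f3)) [::].
Proof.
move=> hk h1 h2.
(* Realizability determines [p23] and [p13], leaving sixteen patterns for each of the five
   admissible choices of smoothed crossings. *)
have E23 : p23 = p12 (+) f1 (+) f3 by move: h1; case: p12 p23 f1 f2 f3 {h2} => [] [] [] [] [].
have E13 : p13 = p12 (+) f2 (+) f3 by move: h2; case: p12 p13 f1 f2 f3 {h1 E23} => [] [] [] [] [].
rewrite E13 E23 {h1 h2 E13 E23}.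
case: ka hk; case: kb; case: kc => // _; case: p12; case: f1; case: f2; case: f3;
 rewrite /triangle /kind; cbn [negb addb].
all: tangle_identity.
Qed.
End TangleIdentities.

(** * The index as a difference of prefix sums *)

Definition keys (D : gword) : seq (nat * bool) := [seq (lab l, ovr l) | l <- D].
Definition pos (D : gword) (x : nat) (o : bool) : nat := index (x, o) (keys D).
Definition letter0 : letter := ((0%N, true), true).

Lemma tailpos_pos D x : tailpos D x = pos D x true.
Proof.
by rewrite /tailpos /pos /index find_map; apply: eq_find => l /=; rewrite xpair_eqE eqb_id.
Qed.

Lemma headpos_pos D x : headpos D x = pos D x false.
Proof.
by rewrite /headpos /pos /index find_map; apply: eq_find => l /=; rewrite xpair_eqE eqbF_neg.
Qed.

Lemma mem_labels D x : (x \in labels D) = (x \in [seq lab l | l <- D]).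
Proof. exact: mem_undup. Qed.

Lemma size_keys D : size (keys D) = size D.
Proof. exact: size_map. Qed.

Lemma nth_key D p : (p < size D)%N ->
  nth (0%N, true) (keys D) p = (lab (nth letter0 D p), ovr (nth letter0 D p)).
Proof. by move=> pD; rewrite (nth_map letter0). Qed.

Section WellFormed.
Variable D : gword.
Hypothesis wfD : gd_wf D.

Lemma pos_nth p l : (p < size D)%N -> nth letter0 D p = l ->
  pos D (lab l) (ovr l) = p.
Proof.
case/andP: wfD => uK _ pD <-.
by rewrite /pos -nth_key // index_uniq // size_keys.
Qed.

Lemma mem_keys x o : x \in labels D -> (x, o) \in keys D.
Proof.
case/andP: wfD => _ /allP part; rewrite mem_labels => /mapP[l lD ->].
have [<-|no] := eqVneq (ovr l) o; first by apply/mapP; exists l.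
have -> : o = ~~ ovr l by move: no; case: o; case: ovr.
by apply/mapP; exists ((lab l, ~~ ovr l), sgn l); rewrite ?part.
Qed.

Lemma pos_lt x o : x \in labels D -> (pos D x o < size D)%N.
Proof. by move=> xD; rewrite -size_keys index_mem mem_keys. Qed.

Lemma nth_pos x o : x \in labels D -> nth letter0 D (pos D x o) = ((x, o), sgnof D x).
Proof.
move=> xD.
have key o' : nth letter0 D (pos D x o') = ((x, o'), sgn (nth letter0 D (pos D x o'))).
  have := nth_key (pos_lt o' xD); rewrite nth_index ?mem_keys //.
  by case: (nth _ D _) => [[a b] s] [] /= -> ->.
suff E o' : sgn (nth letter0 D (pos D x o')) = sgn (nth letter0 D (pos D x (~~ o'))).
  rewrite key /sgnof tailpos_pos -/letter0; congr (_, _).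
  by case: o => //; rewrite E.
case/andP: wfD => _ /allP part.
have /part := mem_nth letter0 (pos_lt o' xD).
rewrite {1 2}key /lab /ovr /= => /(nthP letter0)[p pD pE].
by rewrite [pos D x (~~ o')](pos_nth pD pE) pE.
Qed.

Lemma pos_inj x y o o' : x \in labels D -> y \in labels D ->
  pos D x o = pos D y o' -> x = y /\ o = o'.
Proof. by move=> xD yD E; have := nth_pos o xD; rewrite E nth_pos // => -[-> ->]. Qed.

Lemma nth_label p : (p < size D)%N -> lab (nth letter0 D p) \in labels D.
Proof. by move=> pD; rewrite mem_labels; apply: map_f; apply: mem_nth. Qed.

(** Every position is the over-end or the under-end of exactly one chord; this turns the sum over
    chords in [ind] into a sum over letters. *)
Lemma sum_positions (G : nat -> int) :
  \sum_(0 <= p < size D) G p =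
  \sum_(x <- labels D) (G (pos D x true) + G (pos D x false)).
Proof.
rewrite big_split /= -(big_map (pos D ^~ true) xpredT G) -(big_map (pos D ^~ false) xpredT G).
rewrite -big_cat; apply: perm_big; apply: uniq_perm; first exact: iota_uniq.
  have inj o : {in labels D &, injective (pos D ^~ o)}.
    by move=> x y xD yD E; have [] := pos_inj xD yD E.
  rewrite cat_uniq !map_inj_in_uniq ?undup_uniq ?andbT //=.
  apply/hasPn => _ /mapP[x xD ->]; apply/mapP => -[y yD] E.
  by have [] := pos_inj xD yD E.
move=> p; rewrite mem_index_iota /= mem_cat; apply/idP/orP => [pD|].
  have lD := nth_label pD; have E := pos_nth pD erefl.
  case oE: (ovr (nth letter0 D p)) E => E; [left|right]; apply/mapP;
    by exists (lab (nth letter0 D p)).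
by case=> /mapP[x xD ->]; apply: pos_lt.
Qed.

End WellFormed.

(* Weights of the letters: the chord index becomes a sum over the letters on the
   right-hand arc of the chord, i.e. a difference of two prefix sums. *)
Definition weight (l : letter) : int := if ovr l then - wsign (sgn l) else wsign (sgn l).
Definition prefix_weight (D : gword) (p : nat) : int := \sum_(l <- take p D) weight l.

Lemma prefix_weightE D p : (p <= size D)%N ->
  prefix_weight D p = \sum_(0 <= i < size D) if (i < p)%N then weight (nth letter0 D i) else 0.
Proof.
move=> pD; rewrite /prefix_weight (big_nth letter0) size_takel // -big_mkcond /=.
rewrite [RHS](big_cat_nat (leq0n p) pD) /= [X in _ + X]big_nat_cond [X in _ + X]big1 ?addr0.
  rewrite [RHS]big_nat_cond [LHS]big_nat_cond; apply: eq_big => i; first by case: ltnP; rewrite ?andbF.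
  by move=> /andP[/andP[_ ip] _]; rewrite nth_take.
by move=> i /andP[/andP[pi _]]; rewrite ltnNge pi.
Qed.

Lemma prefix_weightS D p : (p < size D)%N ->
  prefix_weight D p.+1 = prefix_weight D p + weight (nth letter0 D p).
Proof. by move=> pD; rewrite /prefix_weight (take_nth letter0) // -cats1 big_cat big_seq1. Qed.

Lemma prefix_weight_size D : gd_wf D -> prefix_weight D (size D) = 0.
Proof.
move=> wfD; rewrite prefix_weightE //.
rewrite (eq_big_nat _ _ (F2 := fun i => weight (nth letter0 D i))); last first.
  by move=> i /andP[_ ->].
rewrite (sum_positions wfD) big_seq big1 // => x xD.
by rewrite !nth_pos // /weight /= addNr.
Qed.

(** A chord with both ends on the right-hand arc has total weight zero there, and a chord with one
    end there contributes the sign prescribed by the index. The last term removes the tail of [x],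
    which the prefix difference includes. *)
Lemma indE D x : gd_wf D -> x \in labels D ->
  ind D x = prefix_weight D (pos D x false) - prefix_weight D (pos D x true) +
            wsign (sgnof D x).
Proof.
move=> wfD xD; rewrite /ind tailpos_pos headpos_pos.
set t := pos D x true; set h := pos D x false.
have tD : (t < size D)%N by apply: pos_lt.
have hD : (h < size D)%N by apply: pos_lt.
have th : t != h by apply/eqP => /(pos_inj wfD xD xD)[].
pose v i := weight (nth letter0 D i).
transitivity (\sum_(0 <= i < size D) if inR t h i then v i else 0).
  rewrite (sum_positions wfD) big_seq [RHS]big_seq; apply: eq_bigr => y yD.
  rewrite tailpos_pos headpos_pos /v !nth_pos // /weight /=.
  by do 2!case: inR => /=; rewrite ?addNr ?addr0 ?add0r.
have -> : prefix_weight D t = prefix_weight D t.+1 + wsign (sgnof D x).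
  by rewrite prefix_weightS // /t nth_pos // /weight /= addrNK.
rewrite opprD addrA addrNK !prefix_weightE ?(ltnW hD) // /inR.
have [lt_th|le_ht] := ltnP t h.
  rewrite -sumrB; apply: eq_bigr => i _; rewrite -/(v i).
  by case: (ltnP t i); case: (ltnP i h); case: (ltnP i t.+1) => //=; rewrite ?subr0 ?subrr //; lia.
(* When the head precedes the tail the right-hand arc passes through the base point; adding the
   total weight, which is zero, supplies the letters after the tail. *)
have <- : prefix_weight D (size D) +
  (\sum_(0 <= i < size D) (if (i < h)%N then v i else 0) -
   \sum_(0 <= i < size D) (if (i < t.+1)%N then v i else 0)) =
  \sum_(0 <= i < size D) (if (i < h)%N then v i else 0) -
   \sum_(0 <= i < size D) (if (i < t.+1)%N then v i else 0).
  by rewrite prefix_weight_size // add0r.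
rewrite prefix_weightE // -sumrB -big_split /=; apply: eq_big_nat => i /andP[_ iD].
rewrite iD -/(v i).
case: (ltnP t i); case: (ltnP i h); case: (ltnP i t.+1) => //= *; solve [ring | lia].
Qed.

(** * The bracket as a state sum *)

Definition smoothable (n : nat) (D : gword) (x : nat) : bool := (n%:Z %| ind D x)%Z.

Definition crossing_of (n : nat) (D : gword) (x : nat) : crossing :=
  (kind (smoothable n D x) (sgnof D x), (pos D x true, pos D x false)).

Section BitSums.
Variable R : nmodType.

Lemma sum_ffun_tuple m (G : seq bool -> R) :
  \sum_(st : {ffun 'I_m -> bool}) G [seq st i | i <- enum 'I_m] =
  \sum_(t : m.-tuple bool) G t.
Proof.
rewrite (reindex (fun t : m.-tuple bool => [ffun i => tnth t i])) /=; last first.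
  exists (fun st : {ffun 'I_m -> bool} => [tuple st i | i < m]) => [t _|st _].
    by apply: eq_from_tnth => i; rewrite tnth_mktuple ffunE.
  by apply/ffunP => i; rewrite ffunE tnth_mktuple.
apply: eq_bigr => t _; congr G.
by rewrite -[RHS]map_tnth_enum; apply: eq_map => i; rewrite ffunE.
Qed.

Lemma sum_tuple0 (G : seq bool -> R) : \sum_(t : 0.-tuple bool) G t = G [::].
Proof. by rewrite (big_pred1 [tuple]) // => t; apply/esym/eqP; exact: tuple0. Qed.

Lemma sum_tupleS m (G : seq bool -> R) :
  \sum_(t : m.+1.-tuple bool) G t =
  \sum_(t : m.-tuple bool) G (false :: t) + \sum_(t : m.-tuple bool) G (true :: t).
Proof.
rewrite (reindex (fun p : bool * m.-tuple bool => [tuple of p.1 :: p.2])) /=.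
  by rewrite -(pair_bigA _ (fun b (t : m.-tuple bool) => G (b :: t))) big_bool addrC.
exists (fun t => (thead t, [tuple of behead t])) => [[b t] _|t _] /=.
  by rewrite theadE; congr (_, _); apply: val_inj.
by rewrite [RHS]tuple_eta.
Qed.

End BitSums.

Fixpoint smoothed_edges (cs : seq crossing) (bits : seq bool) (E : seq edge) : seq edge :=
  if cs is c :: cs' then
    if c.1 is Some s then
      smoothed_edges cs' (behead bits) (smoothing (Some (s (+) head false bits)) c.2 ++ E)
    else smoothed_edges cs' bits (smoothing None c.2 ++ E)
  else E.

Definition is_smoothed (c : crossing) : bool := c.1 != None.

Lemma state_sum_bits (R : fieldType) (A : R) F cs E : A != 0 ->
  state_sum A F cs E =
  \sum_(t : (count is_smoothed cs).-tuple bool)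
     A ^ ((count negb t)%:Z - (count id t)%:Z) * F (smoothed_edges cs t E).
Proof.
move=> A0; elim: cs E => [|[[s|] p] cs IH] E.
- by rewrite (sum_tuple0 (fun t => A ^ ((count negb t)%:Z - (count id t)%:Z) * F E)) /= subrr expr0z mul1r.
- rewrite [count _ _]/= add1n (sum_tupleS _ (fun t => A ^ ((count negb t)%:Z - (count id t)%:Z) *
      F (smoothed_edges ((Some s, p) :: cs) t E))).
  rewrite [LHS]/= !IH !mulr_sumr; congr (_ + _); apply: eq_bigr => t _.
    rewrite /= addbF add1n add0n mulrA; congr (_ * _).
    by rewrite -[A in A * _]expr1z -expfzDr //; congr (_ ^ _); lia.
  rewrite /= addbT add1n add0n mulrA; congr (_ * _).
  rewrite -[A^-1]exprN1 -expfzDr //; congr (_ ^ _); lia.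
- exact: IH.
Qed.

Definition mode_of (sm sg : nat -> bool) (xs : seq nat) (bits : seq bool) (x : nat) :=
  if sm x then Some (sg x (+) nth false bits (index x (filter sm xs))) else None.

Opaque smoothing.

(** A bit is consumed only at a smoothed crossing, so each such crossing reads the bit at its index
    among the smoothed ones, in agreement with [smode]. *)
Lemma compat_smoothed_edges N (sm sg : nat -> bool) (p : nat -> nat * nat) xs bits E f :
  uniq xs ->
  @compat N (smoothed_edges [seq (kind (sm x) (sg x), p x) | x <- xs] bits E) f =
  compat E f && all (fun x => compat (smoothing (mode_of sm sg xs bits x) (p x)) f) xs.
Proof.
elim: xs bits E => [|x xs IH] bits E /=; first by rewrite andbT.
case/andP=> xxs uxs.
have mode_tl y bits' : y \in xs -> (sm x -> bits' = behead bits) -> (~~ sm x -> bits' = bits) ->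
    mode_of sm sg (x :: xs) bits y = mode_of sm sg xs bits' y.
  move=> yxs h1 h2; rewrite /mode_of; case: (sm y) => //=; case: (sm x) h1 h2 => /=.
    move=> /(_ isT) -> _; have /negbTE -> : x != y by apply: contraNneq xxs => ->.
    by case: bits => [|b bits] //=; rewrite nth_nil.
  by move=> _ /(_ isT) ->.
rewrite [in X in _ && (X && _)]/mode_of /kind.
case smx: (sm x) => /=; rewrite IH // compat_cat /=.
  rewrite smx /= eqxx /= nth0 -andbA andbCA; congr (_ && (_ && _)).
  by apply: eq_in_all => y yxs; rewrite (mode_tl _ (behead bits)) // smx.
rewrite -andbA andbCA; congr (_ && (_ && _)).
by apply: eq_in_all => y yxs; rewrite (mode_tl _ bits) // smx.
Qed.

Lemma prevpos0 k : prevpos k.+1 0 = k.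
Proof. by rewrite /prevpos add0n subn1 modn_small. Qed.

Lemma prevposS k p : (p < k.+1)%N -> prevpos k.+1 p.+1 = p.
Proof. by move=> pk; rewrite /prevpos addSn subn1 /= modnDr modn_small. Qed.

Lemma prevpos_lt k p : (prevpos k.+1 p < k.+1)%N.
Proof. exact: ltn_pmod. Qed.

Transparent smoothing.

(* Cutting the Gauss circle at the base point turns the arcs [0 .. N-1] of the
   circle into the arcs [0 .. N] of a line; the edge [(0, N)] glues it back. *)
Lemma ncol_circle N (e : rel 'I_N) (M : seq edge) : N != 0%N ->
  (forall c, c \in M -> (c.1 <= N)%N && (c.2 <= N)%N) ->
  (forall i j : 'I_N, e i j =
     has (fun c => (i == prevpos N c.1 :> nat) && (j == prevpos N c.2 :> nat) ||
                   (j == prevpos N c.1 :> nat) && (i == prevpos N c.2 :> nat)) M) ->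
  ncol N ((0%N, N) :: M) =
  (2 ^ #|[set i : 'I_N | [forall j : 'I_N, connect e i j ==> (i <= j)%N]]|)%N.
Proof.
case: N e => // k e _ M_le eE.
have e_sym : symmetric e by move=> i j; rewrite !eE; apply: eq_has => c; rewrite orbC.
rewrite -(card_invariant_colourings e_sym).
pose M' := [seq (prevpos k.+1 c.1, prevpos k.+1 c.2) | c <- M].
transitivity (ncol k M'); last first.
  apply: eq_card => g; rewrite !inE /compat all_map.
  apply/allP/forallP => [gM i|gE c cM].
    apply/forallP => j; apply/implyP; rewrite eE => /hasP[c cM].
    have /= fc := gM c cM.
    by case/orP=> /andP[/eqP ic /eqP jc]; move: fc; rewrite -ic -jc !inord_val // eq_sym.
  have /forallP/(_ (inord (prevpos k.+1 c.2)))/implyP := gE (inord (prevpos k.+1 c.1)).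
  apply; rewrite eE; apply/hasP; exists c => //.
  by rewrite !inordK ?prevpos_lt // !eqxx.
(* The line arc [p] enters the position [p], hence is the circle arc [p - 1]; both ends [0] and
   [k.+1] of the line go to the circle arc [k]. *)
pose theta (i : 'I_k.+2) : 'I_k.+1 := inord (prevpos k.+1 i).
pose succ (i : 'I_k.+1) : 'I_k.+2 := inord i.+1.
have succK : cancel succ theta.
  move=> i; apply: val_inj; have ik := ltn_ord i.
  by rewrite /theta /succ /= !inordK ?prevposS ?ltnS // ltnW.
have inord_theta p : (p <= k.+1)%N -> theta (inord p) = inord (prevpos k.+1 p).
  by move=> pk; rewrite /theta inordK.
have closed (f : {ffun 'I_k.+2 -> bool}) i : f (inord 0) = f (inord k.+1) -> f (succ (theta i)) = f i.
  move=> f0; case: i => [[|i] ik]; rewrite /succ /theta /=.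
    rewrite inordK ?prevpos_lt // prevpos0 -f0; congr (f _); apply: val_inj.
    by rewrite /= inordK.
  rewrite inordK ?prevpos_lt // prevposS //; congr (f _); apply: val_inj.
  by rewrite /= inordK.
apply: esym; apply: (@ncol_transfer _ _ _ _ theta succ)
  => [f i _|f i /andP[/eqP f0 _]|f fM|f /andP[/eqP f0 fM]].
- by rewrite succK.
- exact: closed.
- rewrite /= !ffunE !inord_theta // prevpos0 prevposS // eqxx /=.
  apply/allP => c cM; have /andP[c1 c2] := M_le c cM.
  rewrite !ffunE !inord_theta //.
  by have /allP/(_ (prevpos k.+1 c.1, prevpos k.+1 c.2)) := fM; apply; apply/mapP; exists c.
- apply/allP => _ /mapP[c cM ->] /=; have /andP[c1 c2] := M_le c cM.
  by rewrite !ffunE -!inord_theta // !closed //; apply: (allP fM).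
Qed.

Lemma compat_flatten N (Es : seq (seq edge)) f :
  @compat N (flatten Es) f = all (fun E => compat E f) Es.
Proof. by elim: Es => //= E Es IH; rewrite compat_cat IH. Qed.

Lemma has_flatten (T : Type) (a : pred T) (ss : seq (seq T)) :
  has a (flatten ss) = has (has a) ss.
Proof. by elim: ss => //= s ss IH; rewrite has_cat IH. Qed.

Section ComponentCount.
Variables (n : nat) (D : gword) (st : state n D).
Hypothesis wfD : gd_wf D.

Let N := size D.
Let mode x := mode_of (smoothable n D) (sgnof D) (labels D) (stlist st) x.
Let M := flatten [seq smoothing (mode x) (pos D x true, pos D x false) | x <- labels D].

Lemma modeE x : x \in labels D ->
  mode x = omap (addb (sgnof D x)) (smode st x).
Proof.
by move=> xD; rewrite /mode /mode_of /smode /Cn mem_filter xD andbT /smoothable; case: ifP.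
Qed.

Lemma ncompE :
  ncomp st = comps N (smoothed_edges (map (crossing_of n D) (labels D)) (stlist st) [:: (0, N)%N]).
Proof.
have -> : comps N (smoothed_edges (map (crossing_of n D) (labels D)) (stlist st) [:: (0, N)%N]) =
    comps N ((0, N)%N :: M).
  apply: eq_comps => f; rewrite compat_smoothed_edges ?undup_uniq //= andbT; congr (_ && _).
  by rewrite compat_flatten all_map.
have M_le e : e \in M -> (e.1 <= N)%N && (e.2 <= N)%N.
  case/flatten_mapP => x xD.
  have := pos_lt wfD true xD; have := pos_lt wfD false xD; rewrite -/N => h t.
  by rewrite /smoothing; case: (mode x) => [[]|]; rewrite !inE => /orP[] /eqP -> /=;
    rewrite ?h ?t ?(ltnW h) ?(ltnW t).
rewrite /comps /ncomp -/N; case: eqP => [N0|/eqP N0].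
  (* For the empty word the line is the single arc [0], with two colourings: the one component of
     the convention in [ncomp]. *)
  have M0 : M = [::] by rewrite /M (size0nil N0).
  rewrite N0 M0 -[LHS](@trunc_expnK 2 1) //; congr trunc_log.
  have -> : (2 ^ 1 = #|{: {ffun 'I_1 -> bool}}|)%N by rewrite card_ffun card_bool card_ord.
  by apply: eq_card => f; rewrite !inE /= eqxx.
set B := [set _ | _]; rewrite -(@trunc_expnK 2 #|B|) //; congr trunc_log.
apply: esym; apply: ncol_circle => // i j; rewrite /arc_rel has_flatten has_map.
apply: eq_in_has => x xD /=; rewrite modeE // /linked -/N tailpos_pos headpos_pos.
have posE o : exists2 p, pos D x o = p & (p < N)%N by exists (pos D x o) => //; exact: pos_lt.
case: (posE true) (posE false) => [a -> aN] [b -> bN].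
have prevE p : (p < N)%N -> prevpos N p.+1 = p by case: N => // k; exact: prevposS.
case: (smode st x) => [b'|] /=; last first.
  by rewrite /smoothing /= !prevE // orbF -!orbA; do !bool_congr.
case: addb; rewrite /smoothing /= !prevE // orbF -!orbA; do !bool_congr.
Qed.

End ComponentCount.

Lemma bracketE (R : fieldType) (A : R) n D : A != 0 -> gd_wf D ->
  bracket A n D =
  state_sum A (loop_value A (size D)) (map (crossing_of n D) (labels D)) [:: (0, size D)%N].
Proof.
move=> A0 wfD; rewrite state_sum_bits // /bracket.
pose G (t : seq bool) := A ^ ((count negb t)%:Z - (count id t)%:Z) *
  loop_value A (size D) (smoothed_edges (map (crossing_of n D) (labels D)) t [:: (0, size D)%N]).
transitivity (\sum_(st : state n D) G (stlist st)).
  by apply: eq_bigr => st _; rewrite /G /loop_value -ncompE.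
rewrite /state /stlist sum_ffun_tuple -/G.
suff -> : count is_smoothed (map (crossing_of n D) (labels D)) = size (Cn n D) by [].
by rewrite count_map /Cn size_filter; apply: eq_count => x;
  rewrite /is_smoothed /= /kind /smoothable; case: ifP.
Qed.

(** * Insertion of letters and local replacement *)

Definition shift (p k q : nat) : nat := if (q < p)%N then q else (q + k)%N.
Definition shift_crossing (p k : nat) (c : crossing) : crossing :=
  (c.1, (shift p k c.2.1, shift p k c.2.2)).

Section Insertion.
Variables (u w v : gword).

Lemma pos_insert x o : x \notin [seq lab l | l <- w] ->
  pos (u ++ w ++ v) x o = shift (size u) (size w) (pos (u ++ v) x o).
Proof.
move=> xw; rewrite /pos /keys !map_cat !index_cat !size_map /shift.
have -> : ((x, o) \in [seq (lab l, ovr l) | l <- w]) = false.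
  by apply/negbTE; apply: contra xw => /mapP[l lw [-> _]]; apply: map_f.
case: ifP => [xu|_]; last by rewrite ltnNge leq_addr /= addnA addnAC.
by move: xu; rewrite -index_mem size_map => ->.
Qed.

Lemma sgnof_insert x : x \notin [seq lab l | l <- w] ->
  sgnof (u ++ w ++ v) x = sgnof (u ++ v) x.
Proof.
move=> xw; rewrite /sgnof !tailpos_pos pos_insert // /shift; congr sgn.
rewrite !nth_cat; have [lt|ge] := ltnP (pos (u ++ v) x true) (size u); first by rewrite lt.
have -> : (pos (u ++ v) x true + size w < size u)%N = false by lia.
have -> : (pos (u ++ v) x true + size w - size u < size w)%N = false by lia.
by rewrite subnAC addnK.
Qed.

(** The groups of letters inserted by Omega_1 and Omega_2 have total weight zero; this is why the
    old indices survive. *)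
Lemma prefix_weight_insert q : \sum_(l <- w) weight l = 0 ->
  prefix_weight (u ++ w ++ v) (shift (size u) (size w) q) = prefix_weight (u ++ v) q.
Proof.
move=> w0; rewrite /prefix_weight /shift; case: ltnP => [qu|uq].
  by rewrite !take_cat qu.
rewrite !take_cat (ltnNge q) uq /= (ltnNge (q + _)) (leq_trans uq (leq_addr _ _)) /=.
rewrite ltnNge -addnBAC // leq_addl /= !big_cat /= w0 add0r; congr (_ + \sum_(l <- take _ _) _).
by rewrite addnK.
Qed.

End Insertion.

(* Colourings of the arcs of a word after insertion of two letters at [p] which
   do not separate the arcs [p], [p.+1] and [p.+2]. *)
Definition insert_arc (p a : nat) : nat := if (a <= p)%N then a else a.+2.

Definition insert_colouring N p (f : {ffun 'I_N.+3 -> bool}) : {ffun 'I_N.+1 -> bool} :=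
  [ffun i : 'I_N.+1 => f (inord (insert_arc p i))].

Definition inserted N p (E E' : seq edge) : Prop :=
  forall f : {ffun 'I_N.+3 -> bool},
    compat E' f = compat ((p, p.+1) :: (p.+1, p.+2) :: nil) f &&
                  compat E (insert_colouring p f).

(** The old arc [p] survives as three arcs: the letter before the insertion ends on [p], the letter
    after it starts from [p.+2]. This is the second alternative. *)
Lemma insert_colouringE N p (f : {ffun 'I_N.+3 -> bool}) a a' : (a <= N)%N ->
  compat ((p, p.+1) :: (p.+1, p.+2) :: nil) f ->
  (a' == insert_arc p a) || (a == p) && (p <= a' <= p.+2)%N ->
  f (inord a') = insert_colouring p f (inord a).
Proof.
move=> aN /and3P[/= /eqP f1 /eqP f2 _]; rewrite ffunE inordK ?ltnS //.
case/orP=> [/eqP -> //|/andP[/eqP -> /andP[pa' a'p]]]; rewrite /insert_arc leqnn.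
have : a' \in [:: p; p.+1; p.+2] by rewrite !inE; lia.
by rewrite !inE => /or3P[] /eqP ->; rewrite -?f2 -?f1.
Qed.

Lemma comps_insert N p E E' : (p <= N)%N -> inserted N p E E' ->
  comps N E = comps N.+2 E'.
Proof.
move=> pN ins; congr trunc_log.
pose psi (i : 'I_N.+1) : 'I_N.+3 := inord (insert_arc p i).
pose phi (i : 'I_N.+3) : 'I_N.+1 := inord (if (i <= p)%N then i : nat else maxn p (i - 2)).
have phi_lt (i : 'I_N.+3) : ((if (i <= p)%N then i : nat else maxn p (i - 2)) <= N)%N.
  by have := ltn_ord i; case: ifP; lia.
have psi_lt (i : 'I_N.+1) : (insert_arc p i < N.+3)%N.
  by have := ltn_ord i; rewrite /insert_arc; case: ifP; lia.
have psiK : cancel psi phi.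
  move=> i; apply: val_inj; rewrite /phi /psi /= inordK inordK ?psi_lt //; last first.
    by have := ltn_ord i; rewrite /insert_arc; case: ifP; case: ifP; lia.
  by rewrite /insert_arc; case: ifP; case: ifP; lia.
have phiE a : (p <= a <= p.+2)%N -> phi (inord a) = inord p.
  move=> pa; have aE : (inord a : 'I_N.+3) = a :> nat by apply: inordK; lia.
  by rewrite /phi aE; congr inord; case: ifP; lia.
apply: (@ncol_transfer _ _ _ _ phi psi) => [f i _|f i|f fE|f].
- by rewrite psiK.
- rewrite ins => /andP[fp _]; have := insert_colouringE (phi_lt i) fp.
  move=> /(_ i); rewrite inord_val ffunE => ->.
    by rewrite /psi /phi inordK ?ltnS.
  by have := ltn_ord i; rewrite /insert_arc; case: ifP; case: ifP; lia.
- rewrite ins /= !ffunE !phiE ?eqxx /=; try lia.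
  apply: etrans fE; congr compat; apply/ffunP => i; rewrite !ffunE.
  by rewrite -/(psi i) psiK.
- by rewrite ins => /andP[_].
Qed.

Section StateSumInsertion.
Variables (R : fieldType) (A : R).

Lemma state_sum_insert N p cs E E' : (p <= N)%N ->
  all (fun c => (c.2.1 < N)%N && (c.2.2 < N)%N) cs -> inserted N p E E' ->
  state_sum A (loop_value A N) cs E =
  state_sum A (loop_value A N.+2) (map (shift_crossing p 2) cs) E'.
Proof.
move=> pN /allP csN ins; apply: esym; rewrite -[RHS]mul1r.
apply: (@state_sum_rel _ _ (inserted N p)) => //.
  move=> E1 E1' ins1.
  by rewrite mul1r /loop_value -(comps_insert pN ins1).
move=> c k E1 E1' ccs ins1 f; have /andP[tN hN] := csN c ccs.
rewrite !compat_cat ins1 andbCA.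
case fp: (compat _ f) => //=; congr (_ && _).
have eqf a a' : (a <= N)%N -> (a' == insert_arc p a) || (a == p) && (p <= a' <= p.+2)%N ->
  f (inord a') = insert_colouring p f (inord a) by move=> aN; exact: insert_colouringE.
have sh q : (q < N)%N -> (f (inord (shift p 2 q)) = insert_colouring p f (inord q)) *
                         (f (inord (shift p 2 q).+1) = insert_colouring p f (inord q.+1)).
  by move=> qN; split; apply: eqf => //; rewrite /shift /insert_arc; do ?case: ifP => ?; lia.
by rewrite /smoothing; case: k => [[]|] /=; rewrite !sh.
Qed.

End StateSumInsertion.

Section LocalReplacement.
Variables (R : fieldType) (A : R) (N : nat) (bs : seq nat).
Hypothesis bs_uniq : uniq bs.
Hypothesis bs_le : {in bs, forall b, (b.+2 <= N)%N}.
Hypothesis bs_apart : {in bs &, forall b b', b != b' -> (b.+2 <= b')%N || (b'.+2 <= b)%N}.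

(** The code [3 i + j] names the arc [j] of the strand [i], so tangle identities computed on fixed
    codes apply at any positions [bs]. *)
Definition strand_arc (c : nat) : nat := (nth 0%N bs (c %/ 3) + c %% 3)%N.

Definition avoids (q : nat) : bool := all (fun b => (q != b) && (q != b.+1)) bs.

Definition outer_edges (E : seq edge) : bool :=
  all (fun e => [&& (e.1 <= N)%N, (e.2 <= N)%N,
                    all (fun b => e.1 != b.+1) bs & all (fun b => e.2 != b.+1) bs]) E.

(** The outer crossings are expanded first. Their edges never reach the middle arc of a strand, so
    in each outer state both local sums are tangle sums with the same [X]. *)
Lemma state_sum_local (ms : seq nat) (cs loc loc' : seq crossing) (a : R) (E : seq edge) :
  (0 < size bs)%N -> ms = [seq (3 * i).+1 | i <- iota 0 (size bs)] ->
  all (fun c => [&& (c.2.1 < N)%N, (c.2.2 < N)%N, avoids c.2.1 & avoids c.2.2]) cs ->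
  all (fun c => [&& (c.2.1 < 3 * size bs)%N, (c.2.2 < 3 * size bs)%N,
                    (c.2.1 %% 3 < 2)%N & (c.2.2 %% 3 < 2)%N]) (loc ++ loc') ->
  (forall X, tangle_sum A X ms loc [::] = a * tangle_sum A X ms loc' [::]) ->
  outer_edges E ->
  state_sum A (loop_value A N) (cs ++ map (emb_crossing strand_arc) loc) E =
  a * state_sum A (loop_value A N) (cs ++ map (emb_crossing strand_arc) loc') E.
Proof.
move=> bs0 msE /allP csP; rewrite all_cat => /andP[locP locP'] tangle EP.
rewrite !state_sum_cat -[cs in LHS]map_id.
apply: (@state_sum_rel _ _ (fun E E' => E = E' /\ outer_edges E)) => //; last first.
  move=> c k E1 _ /csP /and4P[tN hN ta ha] [<- E1P]; split=> //.
  rewrite /outer_edges all_cat -!/(outer_edges _) E1P andbT.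
  have av q : avoids q -> all (fun b => q != b.+1) bs /\ all (fun b => q.+1 != b.+1) bs.
    by move=> /allP qa; split; apply/allP => b /qa /andP[? ?].
  have [[t1 t2] [h1 h2]] := (av _ ta, av _ ha).
  by rewrite /outer_edges /smoothing; case: k => [[]|] /=;
    rewrite ?t1 ?t2 ?h1 ?h2 ?tN ?hN ?(ltnW tN) ?(ltnW hN).
move=> E1 _ [<- E1P]; pose C := iota 0 (3 * size bs).
have memC c : (c \in C) = (c < 3 * size bs)%N by rewrite mem_iota.
have nth_bs c : c \in C -> nth 0%N bs (c %/ 3) \in bs.
  by rewrite memC => cC; apply: mem_nth; rewrite ltn_divLR // mulnC.
have C0 : 0%N \in C by rewrite memC; lia.
have arc_le : {in C, forall c, (strand_arc c <= N)%N}.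
  move=> c /nth_bs /bs_le; rewrite /strand_arc; have := ltn_pmod c (isT : (0 < 3)%N); lia.
have ims : all (inner N strand_arc C E1) ms.
  rewrite msE all_map; apply/allP => i; rewrite mem_iota add0n /= => ib.
  have iC : (3 * i).+1 \in C by rewrite memC; lia.
  have arc_i : strand_arc (3 * i).+1 = (nth 0%N bs i).+1.
    by rewrite /strand_arc -addn1 mulnC divnMDl // modnMDl addn0 addn1.
  have bi : nth 0%N bs i \in bs by apply: mem_nth.
  apply/and4P; split => //; apply/allP.
    move=> c cC; apply/implyP => ci; rewrite arc_i /strand_arc; have bc := nth_bs _ cC.
    have [nE|ne] := eqVneq (nth 0%N bs (c %/ 3)) (nth 0%N bs i).
      have cE : (c %/ 3)%N = i.
        apply/eqP; rewrite -(nth_uniq 0%N _ _ bs_uniq) ?nE //.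
        by rewrite ltn_divLR // mulnC -memC.
      by rewrite cE; move: ci; rewrite {1}(divn_eq c 3) cE; clear; lia.
    have := bs_apart bc bi ne; have := ltn_pmod c (isT : (0 < 3)%N); clear; lia.
  by move=> e /(allP E1P) /and4P[-> -> /allP h1 /allP h2]; rewrite arc_i h1 ?h2.
have codes cs' : all (fun c => [&& (c.2.1 < 3 * size bs)%N, (c.2.2 < 3 * size bs)%N,
        (c.2.1 %% 3 < 2)%N & (c.2.2 %% 3 < 2)%N]) cs' ->
   all (fun c => [&& c.2.1 \in C, c.2.1.+1 \in C, c.2.2 \in C, c.2.2.+1 \in C,
         strand_arc c.2.1.+1 == (strand_arc c.2.1).+1 &
         strand_arc c.2.2.+1 == (strand_arc c.2.2).+1]) cs'.
  have code q : (q < 3 * size bs)%N -> (q %% 3 < 2)%N ->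
      [/\ q \in C, q.+1 \in C & strand_arc q.+1 == (strand_arc q).+1].
    rewrite !memC => q1 q2.
    have [dE mE] : (q.+1 %/ 3 = q %/ 3 /\ q.+1 %% 3 = (q %% 3).+1)%N by lia.
    by rewrite /strand_arc dE mE addnS eqxx; split => //; lia.
  apply: sub_all => c /and4P[t h t3 h3].
  by have [-> -> ->] := code _ t t3; have [-> -> ->] := code _ h h3.
have EE : E1 = emb strand_arc [::] ++ E1 by [].
rewrite EE !(state_sum_tangle A C0 arc_le ims) ?codes //.
Qed.

End LocalReplacement.

(** * Reidemeister moves *)

Lemma nth_letter D p x o s : gd_wf D -> (p < size D)%N ->
  nth letter0 D p = ((x, o), s) ->
  [/\ x \in labels D, pos D x o = p & sgnof D x = s].
Proof.
move=> wfD pD E; have xD : x \in labels D by have := nth_label pD; rewrite E.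
have xE : pos D x o = p by have := pos_nth wfD pD E.
by split=> //; have := nth_pos wfD o xD; rewrite xE E => -[].
Qed.

Lemma inserted_closure N p : (p <= N)%N ->
  inserted N p [:: (0, N)%N] [:: (p, p.+1); (p.+1, p.+2); (0, N.+2)%N].
Proof.
move=> pN f; apply: etrans (compat_cat [:: (p, p.+1); (p.+1, p.+2)] [:: (0, N.+2)%N] f) _.
case fp: (compat _ f) => //=.
have E a a' : (a <= N)%N -> (a' == insert_arc p a) || (a == p) && (p <= a' <= p.+2)%N ->
  f (inord a') = insert_colouring p f (inord a) by move=> aN; exact: insert_colouringE.
rewrite (E 0 0)%N // (E N N.+2) //; rewrite /insert_arc; do ?case: ifP => ?; lia.
Qed.

Lemma inserted_closure2 N p1 p : (p1.+2 <= p)%N -> (p <= N)%N ->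
  inserted N p [:: (p1, p1.+1); (p1.+1, p1.+2); (0, N)%N]
    [:: (p, p.+1); (p.+1, p.+2); (p1, p1.+1); (p1.+1, p1.+2); (0, N.+2)%N].
Proof.
move=> p1p pN f.
apply: etrans (compat_cat [:: (p, p.+1); (p.+1, p.+2)]
  [:: (p1, p1.+1); (p1.+1, p1.+2); (0, N.+2)%N] f) _.
case fp: (compat _ f) => //=.
have E a a' : (a <= N)%N -> (a' == insert_arc p a) || (a == p) && (p <= a' <= p.+2)%N ->
  f (inord a') = insert_colouring p f (inord a) by move=> aN; exact: insert_colouringE.
rewrite (E p1 p1) ?(E p1.+1 p1.+1) ?(E p1.+2 p1.+2) ?(E 0 0)%N ?(E N N.+2) //;
  rewrite /insert_arc; do ?case: ifP => ?; lia.
Qed.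

Lemma labels_uniq D : uniq (labels D).
Proof. exact: undup_uniq. Qed.

Lemma perm_labels D D' : perm_eq D D' -> perm_eq (labels D') (labels D).
Proof.
move=> pD; apply: uniq_perm; rewrite ?labels_uniq // => z; rewrite !mem_labels.
by apply/esym; apply: perm_mem; apply: perm_map.
Qed.

Lemma nth_infix (u w v : gword) i : (i < size w)%N ->
  nth letter0 (u ++ w ++ v) (size u + i) = nth letter0 w i.
Proof. by move=> iw; rewrite nth_cat ltnNge leq_addr addKn nth_cat iw. Qed.

Lemma shift2_lt p c N : (c < N)%N -> (shift p 2 c < N.+2)%N.
Proof. by rewrite /shift; case: (ltnP c p); lia. Qed.

Lemma shift2_gap p c : (shift p 2 c != p) && (shift p 2 c != p.+1).
Proof. by rewrite /shift; case: (ltnP c p); lia. Qed.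

Lemma shift2_far p1 p2 c : (p1.+2 <= p2)%N -> c != p1 -> c != p1.+1 ->
  (shift p2 2 c != p1) && (shift p2 2 c != p1.+1).
Proof. by rewrite /shift; case: (ltnP c p2); lia. Qed.

(** * Invariance under Omega_1 and Omega_2 *)

Section Moves.
Variables (n : nat) (R : fieldType) (q : R).
Hypothesis q0 : q != 0.
Let A := q^-1.

Lemma A_neq0 : A != 0. Proof. by rewrite invr_eq0. Qed.

Lemma cube_neq0 : - A ^+ 3 != 0.
Proof. by rewrite oppr_eq0 expf_neq0 // A_neq0. Qed.

(** Zero is divisible by every [n], so the kink is always smoothed, and its factor cancels against
    the change of the writhe. *)
Lemma omega1_Vjones D D' : gd_wf D -> gd_wf D' -> omega1 D D' ->
  Vjones n D q = Vjones n D' q.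
Proof.
move=> wfD wfD' [u [v [x [o [s [fx [DE D'E]]]]]]].
set w := [:: (x, o, s); (x, ~~ o, s)] in D'E.
set p := size u; have sD : size D = (p + size v)%N by rewrite DE size_cat.
have sD' : size D' = (size D).+2 by rewrite D'E DE !size_cat /=; lia.
have n1 : nth letter0 D' p = ((x, o), s) by rewrite D'E nth_cat ltnn subnn.
have n2 : nth letter0 D' p.+1 = ((x, ~~ o), s).
  by rewrite D'E nth_cat ltnNge leqnSn /= subSnn.
have pD' : (p.+1 < size D')%N by rewrite sD'; lia.
have [xD' x1 xs] := nth_letter wfD' (ltnW pD') n1.
have [_ x2 _] := nth_letter wfD' pD' n2.
have w0 : \sum_(l <- w) weight l = 0.
  by rewrite !big_cons big_nil /weight /=; case: (o); rewrite /= ?addr0 ?addrN ?addNr.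
have notw z : z \in labels D -> z \notin [seq lab l | l <- w].
  move=> zD; rewrite /= !inE orbb; apply: contraTneq zD => ->.
  by rewrite mem_labels DE.
have perm_labels : perm_eq (labels D') (x :: labels D).
  apply: uniq_perm; rewrite ?labels_uniq //= ?labels_uniq ?andbT ?mem_labels ?DE //.
  move=> z; rewrite inE !mem_labels D'E ?DE !map_cat !mem_cat !inE.
  by case: (z == x); rewrite ?orbT.
have labD' z : z \in labels D -> z \in labels D'.
  by move=> zD; rewrite (perm_mem perm_labels) inE zD orbT.
have posE z o' : z \in labels D -> pos D' z o' = shift p 2 (pos D z o').
  by move=> zD; rewrite D'E (pos_insert _ _ _ (notw z zD)) -DE.
have sgnE z : z \in labels D -> sgnof D' z = sgnof D z.
  by move=> zD; rewrite D'E sgnof_insert ?notw // -DE.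
have indE' z : z \in labels D -> ind D' z = ind D z.
  move=> zD; rewrite !indE ?labD' // sgnE // !posE //.
  by rewrite D'E !(prefix_weight_insert _ _ _ w0) -DE.
have crE z : z \in labels D -> crossing_of n D' z = shift_crossing p 2 (crossing_of n D z).
  by move=> zD; rewrite /crossing_of /shift_crossing /smoothable /= indE' // sgnE // !posE.
(* The ends are adjacent: whichever comes first, the prefix difference from tail to head is minus
   the sign of the crossing. *)
have ind0 : ind D' x = 0.
  have S := prefix_weightS (ltnW pD'); rewrite n1 /weight /= in S.
  by rewrite indE // xs; case: (o) x1 x2 S => /= -> -> ->; ring.
have wr : writhe D' = wsign s + writhe D.
  rewrite /writhe (perm_big _ perm_labels) big_cons xs; congr (_ + _).
  by apply: eq_big_seq => z zD; rewrite sgnE.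
have crx : crossing_of n D' x = (Some s, if o then (p, p.+1) else (p.+1, p)).
  rewrite /crossing_of /smoothable ind0 dvdz0 xs /kind.
  by case: (o) x1 x2 => /= -> ->.
pose cs := map (crossing_of n D') (labels D).
have csE : cs = map (shift_crossing p 2) (map (crossing_of n D) (labels D)).
  by rewrite -map_comp; apply/eq_in_map => z; exact: crE.
(* The first two edges are those of the new crossing left alone. *)
have br : bracket A n D = state_sum A (loop_value A (size D')) cs
            [:: (p, p.+1); (p.+1, p.+2); (0%N, size D')].
  rewrite bracketE ?A_neq0 // csE sD'; apply: state_sum_insert.
  - by rewrite sD leq_addr.
  - by rewrite all_map; apply/allP => z zD /=; rewrite !pos_lt.
  - by apply: inserted_closure; rewrite sD leq_addr.
have F_perm : perm_invariant (loop_value A (size D')) by apply: loop_value_perm.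
have br' : bracket A n D' = (- A ^+ 3) ^ (wsign s) * bracket A n D.
  rewrite bracketE ?A_neq0 //.
  have pcs : perm_eq (map (crossing_of n D') (labels D')) (cs ++ [:: crossing_of n D' x]).
    by rewrite cats1 perm_sym perm_rcons -map_cons perm_map // perm_sym.
  rewrite (state_sum_perm A F_perm pcs) crx.
  pose c01 : nat * nat := if o then (0, 1)%N else (1, 0)%N.
  have embE k : map (emb_crossing (strand_arc [:: p])) [:: (k, c01)] =
      [:: (k, if o then (p, p.+1) else (p.+1, p))].
    by rewrite /c01 /emb_crossing /strand_arc; case: (o) => /=; rewrite addn0 addn1.
  rewrite -embE (@state_sum_local _ _ (size D') [:: p] _ _ _ [:: 1%N] cs
     [:: (Some s, c01)] [:: (None, c01)] ((- A ^+ 3) ^ (wsign s))) //.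
  - congr (_ * _); rewrite embE.
    rewrite (state_sum_perm A F_perm (_ : perm_eq _
      ([:: (None, if o then (p, p.+1) else (p.+1, p))] ++ cs))); last by rewrite perm_catC.
    rewrite /= br; apply: state_sum_edges_perm => //; case: (o) => //.
    by rewrite /smoothing /= (perm_catCA [:: _] [:: _]).
  - by move=> b; rewrite inE => /eqP ->.
  - by move=> b b'; rewrite !inE => /eqP -> /eqP ->; rewrite eqxx.
  - rewrite csE -map_comp all_map; apply/allP => z zD /=.
    by rewrite /avoids /= sD' !shift2_lt ?pos_lt //= !shift2_gap.
  - by rewrite /c01; case: (o).
  - by move=> X; apply: tangle_sum_kink; rewrite ?A_neq0 // /c01; case: (o).
  - by rewrite /outer_edges /= leqnn (gtn_eqF pD').
rewrite /Vjones -/A br' wr mulrA; congr (_ * _).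
by rewrite -expfzDr ?cube_neq0 //; congr (_ ^ _); ring.
Qed.

Lemma omega2_Vjones D D' : gd_wf D -> gd_wf D' -> omega2 D D' ->
  Vjones n D q = Vjones n D' q.
Proof.
move=> wfD wfD' [u [v [t [x [y [s [rev2 [fo [xy [fx [fy [DE]]]]]]]]]]]] /=.
set P := [:: (x, true, s); (y, true, ~~ s)].
set Q := if rev2 then _ else _.
set W1 := if fo then P else Q; set W2 := if fo then Q else P => D'E.
have sQ : size Q = 2 by rewrite /Q; case: (rev2).
have s1 : size W1 = 2 by rewrite /W1; case: (fo).
have s2 : size W2 = 2 by rewrite /W2; case: (fo).
(* [p2] is measured in the word where the first pair is already inserted, so the two insertions are
   performed from left to right. *)
pose p1 := size u; pose u2 := u ++ W1 ++ v; pose p2 := size u2.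
have p2E : p2 = (p1 + 2 + size v)%N by rewrite /p2 /u2 !size_cat s1 addnA.
have D'E2 : D' = u2 ++ W2 ++ t by rewrite D'E /u2 -!catA.
have D1E : u2 ++ t = u ++ W1 ++ (v ++ t) by rewrite /u2 -!catA.
have sD : size D = (p1 + size v + size t)%N by rewrite DE !size_cat addnA.
have p12 : (p1.+2 <= p2)%N by lia.
have p1_le : (p1 <= size D)%N by lia.
have p2_le : (p2 <= (size D).+2)%N by lia.
have sD' : size D' = (size D).+4 by rewrite D'E !size_cat s1 s2 sD /p1; lia.
pose bP := if fo then p1 else p2; pose bQ := if fo then p2 else p1.
have nth1 i : (i < 2)%N -> nth letter0 D' (p1 + i) = nth letter0 W1 i.
  by move=> i2; rewrite D'E nth_infix ?s1.
have nth2 i : (i < 2)%N -> nth letter0 D' (p2 + i) = nth letter0 W2 i.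
  by move=> i2; rewrite D'E2 nth_infix ?s2.
have nthP i : (i < 2)%N -> nth letter0 D' (bP + i) = nth letter0 P i.
  by move=> i2; rewrite /bP; move: nth1 nth2; rewrite /W1 /W2; case: (fo) => h1 h2; rewrite ?h1 ?h2.
have nthQ i : (i < 2)%N -> nth letter0 D' (bQ + i) = nth letter0 Q i.
  by move=> i2; rewrite /bQ; move: nth1 nth2; rewrite /W1 /W2; case: (fo) => h1 h2; rewrite ?h1 ?h2.
have bP_le : (bP.+2 <= size D')%N by rewrite sD' /bP; case: (fo); lia.
have bQ_le : (bQ.+2 <= size D')%N by rewrite sD' /bQ; case: (fo); lia.
have bPQ : (bP.+2 <= bQ)%N || (bQ.+2 <= bP)%N by rewrite /bP /bQ; case: (fo); rewrite p12 ?orbT.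
have bP_neq : bP != bQ by apply: contraTneq bPQ => ->; rewrite orbb ltnNge leqnSn.
have lt b i : (b.+2 <= size D')%N -> (i < 2)%N -> (b + i < size D')%N by lia.
pose i_x := nat_of_bool rev2; pose i_y := nat_of_bool (~~ rev2).
have ix2 : (i_x < 2)%N by rewrite /i_x; case: (rev2).
have iy2 : (i_y < 2)%N by rewrite /i_y; case: (rev2).
have [xD' x1 xs] := nth_letter wfD' (lt _ _ bP_le (isT : 0 < 2)%N) (nthP 0%N isT).
have [yD' y1 ys] := nth_letter wfD' (lt _ _ bP_le (isT : 1 < 2)%N) (nthP 1%N isT).
have nQx : nth letter0 Q i_x = (x, false, s) by rewrite /Q /i_x; case: (rev2).
have nQy : nth letter0 Q i_y = (y, false, ~~ s) by rewrite /Q /i_y; case: (rev2).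
have [_ x2 _] := nth_letter wfD' (lt _ _ bQ_le ix2) (etrans (nthQ _ ix2) nQx).
have [_ y2 _] := nth_letter wfD' (lt _ _ bQ_le iy2) (etrans (nthQ _ iy2) nQy).
have wN b : wsign (~~ b) = - wsign b by case: b.
have wP0 : \sum_(l <- P) weight l = 0.
  by rewrite !big_cons big_nil /weight /= wN; ring.
have wQ0 : \sum_(l <- Q) weight l = 0.
  by rewrite /Q; case: (rev2); rewrite !big_cons big_nil /weight /= wN; ring.
have w1 : \sum_(l <- W1) weight l = 0 by rewrite /W1; case: (fo).
have w2 : \sum_(l <- W2) weight l = 0 by rewrite /W2; case: (fo).
have labP : [seq lab l | l <- P] = [:: x; y] by [].
have labQ z : (z \in [seq lab l | l <- Q]) = (z \in [:: x; y]).
  by rewrite /Q; case: (rev2); rewrite !inE // orbC.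
have lab1 z : (z \in [seq lab l | l <- W1]) = (z \in [:: x; y]).
  by rewrite /W1; case: (fo); rewrite ?labQ ?labP.
have lab2 z : (z \in [seq lab l | l <- W2]) = (z \in [:: x; y]).
  by rewrite /W2; case: (fo); rewrite ?labQ ?labP.
have xD : x \notin labels D by rewrite mem_labels DE.
have yD : y \notin labels D by rewrite mem_labels DE.
have notxy z : z \in labels D -> z \notin [:: x; y].
  by move=> zD; rewrite !inE; apply/norP; split; apply: contraTneq zD => ->.
have not1 z : z \in labels D -> z \notin [seq lab l | l <- W1].
  by move=> zD; rewrite lab1 notxy.
have not2 z : z \in labels D -> z \notin [seq lab l | l <- W2].
  by move=> zD; rewrite lab2 notxy.
have perm_labels : perm_eq (labels D') [:: x, y & labels D].
  apply: uniq_perm; rewrite ?labels_uniq //= ?labels_uniq ?andbT ?inE ?negb_or ?xy ?xD ?yD //.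
  move=> z; rewrite mem_labels D'E !map_cat !mem_cat lab1 lab2 !inE mem_labels DE !map_cat !mem_cat.
  by case: (z == x); case: (z == y); rewrite ?orbT.
have labD' z : z \in labels D -> z \in labels D'.
  by move=> zD; rewrite (perm_mem perm_labels) !inE zD !orbT.
have posE z o' : z \in labels D -> pos D' z o' = shift p2 2 (shift p1 2 (pos D z o')).
  move=> zD; rewrite D'E2 (pos_insert _ _ _ (not2 z zD)) s2 D1E.
  by rewrite (pos_insert _ _ _ (not1 z zD)) s1 -DE.
have sgnE z : z \in labels D -> sgnof D' z = sgnof D z.
  by move=> zD; rewrite D'E2 sgnof_insert ?not2 // D1E sgnof_insert ?not1 // -DE.
have prefE k : prefix_weight D' (shift p2 2 (shift p1 2 k)) = prefix_weight D k.
  have := prefix_weight_insert u2 t (shift p1 2 k) w2; rewrite s2 D'E2 => ->.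
  have := prefix_weight_insert u (v ++ t) k w1; rewrite s1 D1E => ->.
  by rewrite DE.
have indE' z : z \in labels D -> ind D' z = ind D z.
  by move=> zD; rewrite !indE ?labD' // sgnE // !posE // !prefE.
have crE z : z \in labels D -> crossing_of n D' z =
    shift_crossing p2 2 (shift_crossing p1 2 (crossing_of n D z)).
  by move=> zD; rewrite /crossing_of /shift_crossing /smoothable /= indE' // sgnE // !posE.
(* The jumps of the prefix sum between the adjacent ends of [x] and [y] contribute [2 * wsign s] in
   total, which makes up for the opposite sign of [y]. *)
have indxy : ind D' y = ind D' x.
  have SP := prefix_weightS (ltnW bP_le).
  have SQ := prefix_weightS (ltnW bQ_le).
  have := nthP 0%N isT; rewrite addn0 => nP0; rewrite nP0 in SP.
  have := nthQ 0%N isT; rewrite addn0 => nQ0; rewrite nQ0 in SQ.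
  rewrite !indE // xs ys x1 y1 x2 y2 addn1 addn0 SP /i_x /i_y wN.
  by move: SQ; rewrite /Q; case: (rev2); rewrite ?addn0 ?addn1 => ->; rewrite /weight /= ?wN; ring.
have wr : writhe D' = writhe D.
  rewrite /writhe (perm_big _ perm_labels) !big_cons /= xs ys wN addrA subrr add0r.
  by apply: eq_big_seq => z zD; rewrite sgnE.
pose k := smoothable n D' x.
pose X := (bP, (bQ + i_x)%N); pose Y := (bP.+1, (bQ + i_y)%N).
have crx : crossing_of n D' x = (kind k s, X).
  by rewrite /crossing_of /X x1 x2 xs addn0.
have cry : crossing_of n D' y = (kind k (~~ s), Y).
  by rewrite /crossing_of /Y y1 y2 ys addn1 /k /smoothable indxy.
pose cs := map (crossing_of n D') (labels D).
have csE : cs = map (shift_crossing p2 2)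
    (map (shift_crossing p1 2) (map (crossing_of n D) (labels D))).
  by rewrite -!map_comp; apply/eq_in_map => z; exact: crE.
have br : bracket A n D = state_sum A (loop_value A (size D')) cs
    [:: (p2, p2.+1); (p2.+1, p2.+2); (p1, p1.+1); (p1.+1, p1.+2); (0%N, size D')].
  rewrite bracketE ?A_neq0 // csE sD'.
  rewrite (@state_sum_insert _ A _ p1 _ _ [:: (p1, p1.+1); (p1.+1, p1.+2); (0, (size D).+2)%N]).
  - apply: state_sum_insert.
    + exact: p2_le.
    + rewrite !all_map; apply/allP => z zD /=.
      by rewrite !shift2_lt ?pos_lt.
    + exact: (inserted_closure2 p12 p2_le).
  - exact: p1_le.
  - by rewrite all_map; apply/allP => z zD /=; rewrite !pos_lt.
  - exact: (inserted_closure p1_le).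
have F_perm : perm_invariant (loop_value A (size D')) by apply: loop_value_perm.
rewrite /Vjones -/A wr; congr (_ * _).
rewrite [RHS]bracketE ?A_neq0 //.
have pcs : perm_eq (map (crossing_of n D') (labels D')) (cs ++ [:: (kind k s, X); (kind k (~~ s), Y)]).
  rewrite perm_sym perm_catC -crx -cry perm_sym.
  exact: (perm_map (crossing_of n D') perm_labels).
rewrite (state_sum_perm A F_perm pcs).
pose cx := (0, if rev2 then 4 else 3)%N; pose cy := (1, if rev2 then 3 else 4)%N.
have embE kx ky : map (emb_crossing (strand_arc [:: bP; bQ])) [:: (kx, cx); (ky, cy)] =
    [:: (kx, X); (ky, Y)].
  rewrite /cx /cy /X /Y /i_x /i_y /emb_crossing /strand_arc.
  by case: (rev2) => /=; rewrite ?addn0 ?addn1.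
rewrite -embE (@state_sum_local _ _ (size D') [:: bP; bQ] _ _ _ [:: 1; 4]%N cs
   [:: (kind k s, cx); (kind k (~~ s), cy)] [:: (None, cx); (None, cy)] 1) //.
- rewrite mul1r embE.
  rewrite (state_sum_perm A F_perm (_ : perm_eq _ ([:: (None, X); (None, Y)] ++ cs)));
    last by rewrite perm_catC.
  rewrite /= br; apply: state_sum_edges_perm => //.
  apply/permP => a; rewrite /smoothing /X /Y /bP /bQ /i_x /i_y /=.
  by case: (fo); case: (rev2); rewrite /= ?addn0 ?addn1; clear; lia.
- by rewrite /= inE andbT.
- by move=> b; rewrite !inE => /orP[] /eqP ->.
- move=> b b'; rewrite !inE.
  by case/orP=> /eqP -> /orP[] /eqP ->; rewrite ?eqxx // ?[_ || (bP.+2 <= _)%N]orbC.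
- rewrite csE -!map_comp all_map; apply/allP => z zD /=.
  have := pos_lt wfD true zD; have := pos_lt wfD false zD.
  have sh c : (c < size D)%N -> [&& shift p2 2 (shift p1 2 c) < size D',
      shift p2 2 (shift p1 2 c) != p1, shift p2 2 (shift p1 2 c) != p1.+1,
      shift p2 2 (shift p1 2 c) != p2 & shift p2 2 (shift p1 2 c) != p2.+1]%N.
    move=> cD; rewrite sD' !shift2_lt //=.
    have /andP[-> ->] := shift2_gap p2 (shift p1 2 c).
    have /andP[g1 g2] := shift2_gap p1 c.
    by have /andP[-> ->] := shift2_far p12 g1 g2.
  move=> /sh/and5P[l1 a1 a2 a3 a4] /sh/and5P[l1' a1' a2' a3' a4'].
  rewrite l1 l1' /= /avoids /bP /bQ; case: (fo); rewrite /= ?a1 ?a2 ?a3 ?a4 ?a1' ?a2' ?a3' ?a4' //.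
- by rewrite /cx /cy; case: (rev2).
(* If the common index is not divisible by [n], both crossings are already left alone and the two
   sides coincide. *)
- move=> Z; rewrite mul1r /kind; case: (k) => //.
  by apply: tangle_sum_poke; exact: A_neq0.
- by rewrite /outer_edges /= leqnn /= !andbT gtn_eqF // gtn_eqF // (ltn_eqF bP_le) ?(ltn_eqF bQ_le).
Qed.

End Moves.

(** * Invariance under Omega_3 *)

Definition segment_at (D : gword) (b : nat) (S : gword) : Prop :=
  forall i, (i < 2)%N -> nth letter0 D (b + i) = nth letter0 S i.

Definition apart (b b' : nat) : bool := (b.+2 <= b')%N || (b'.+2 <= b)%N.

(** Swapping the letters at [b] and [b.+1] disturbs only the prefix sum at [b.+1]; the chords
    outside the triangle and the bases of the segments use the others. *)
Definition agree_off (bs : seq nat) (D D' : gword) : Prop :=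
  [/\ perm_eq D D',
      forall p, all (fun b => (p != b) && (p != b.+1)) bs ->
        nth letter0 D p = nth letter0 D' p &
      forall p, all (fun b => p != b.+1) bs -> prefix_weight D p = prefix_weight D' p].

Lemma agree_off_trans bs1 bs2 D1 D2 D3 :
  agree_off bs1 D1 D2 -> agree_off bs2 D2 D3 -> agree_off (bs1 ++ bs2) D1 D3.
Proof.
case=> p1 n1 w1 [p2 n2 w2]; split; first exact: perm_trans p2.
  by move=> p; rewrite all_cat => /andP[h1 h2]; rewrite n1 ?n2.
by move=> p; rewrite all_cat => /andP[h1 h2]; rewrite w1 ?w2.
Qed.

Lemma agree_off_sub bs bs' D D' : {subset bs <= bs'} -> agree_off bs D D' -> agree_off bs' D D'.
Proof.
move=> sub [pD nD wD]; split=> // p /allP h; [apply: nD|apply: wD];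
  by apply/allP => b /sub /h.
Qed.

Lemma agree_off_rev u X v : size X = 2 ->
  agree_off [:: size u] (u ++ X ++ v) (u ++ rev X ++ v).
Proof.
case: X => [|l1 [|l2 []]] // _; rewrite /rev /=.
have pE : perm_eq (u ++ [:: l1, l2 & v]) (u ++ [:: l2, l1 & v]).
  by rewrite perm_cat2l (perm_catCA [:: l1] [:: l2]).
split=> // p; rewrite /= andbT.
  case/andP=> p1 p2; rewrite !nth_cat; case: ltnP => // up.
  have [k ->] : exists k, p = (size u + k.+2)%N.
    by exists (p - (size u).+2)%N; lia.
  by rewrite addKn.
move=> p1; rewrite /prefix_weight !take_cat; case: ltnP => // up.
have [->|pu] := eqVneq p (size u); first by rewrite subnn.
have [k ->] : exists k, p = (size u + k.+2)%N by exists (p - (size u).+2)%N; lia.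
by rewrite addKn /= !big_cat !big_cons /=; congr (_ + _); rewrite addrCA.
Qed.

Section Omega3Letters.
Variables (a b c : nat) (p12 p13 p23 : bool).

Definition strand1 (f : bool) : gword :=
  if f then [:: (a, true, p12); (b, true, p13)] else [:: (b, true, p13); (a, true, p12)].
Definition strand2 (f : bool) : gword :=
  if f then [:: (a, false, p12); (c, true, p23)] else [:: (c, true, p23); (a, false, p12)].
Definition strand3 (f : bool) : gword :=
  if f then [:: (b, false, p13); (c, false, p23)] else [:: (c, false, p23); (b, false, p13)].

Section Triangle.
Variables (D : gword) (b1 b2 b3 : nat) (f1 f2 f3 : bool).
Hypothesis wfD : gd_wf D.
Hypothesis b1_le : (b1.+2 <= size D)%N.
Hypothesis b2_le : (b2.+2 <= size D)%N.
Hypothesis b3_le : (b3.+2 <= size D)%N.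
Hypothesis seg1 : segment_at D b1 (strand1 f1).
Hypothesis seg2 : segment_at D b2 (strand2 f2).
Hypothesis seg3 : segment_at D b3 (strand3 f3).

Lemma nth_segment e S i x o s : (e.+2 <= size D)%N -> segment_at D e S -> (i < 2)%N ->
  nth letter0 S i = ((x, o), s) ->
  [/\ x \in labels D, pos D x o = (e + i)%N & sgnof D x = s].
Proof. by move=> eD seg i2 E; apply: nth_letter => //; [lia|rewrite seg]. Qed.

Lemma triangle_letters :
  [/\ a \in labels D, b \in labels D & c \in labels D] /\
  [/\ sgnof D a = p12, sgnof D b = p13 & sgnof D c = p23] /\
  [/\ pos D a true = b1 + ~~ f1, pos D b true = b1 + f1 & pos D c true = b2 + f2]%N /\
  [/\ pos D a false = b2 + ~~ f2, pos D b false = b3 + ~~ f3 & pos D c false = b3 + f3]%N.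
Proof.
have [||aD at' asg] := @nth_segment b1 _ (~~ f1) a true p12 b1_le seg1; try by case: (f1).
have [||bD bt bsg] := @nth_segment b1 _ f1 b true p13 b1_le seg1; try by case: (f1).
have [||cD ct csg] := @nth_segment b2 _ f2 c true p23 b2_le seg2; try by case: (f2).
have [||_ ah _] := @nth_segment b2 _ (~~ f2) a false p12 b2_le seg2; try by case: (f2).
have [||_ bh _] := @nth_segment b3 _ (~~ f3) b false p13 b3_le seg3; try by case: (f3).
have [||_ ch _] := @nth_segment b3 _ f3 c false p23 b3_le seg3; try by case: (f3).
by [].
Qed.

Lemma prefix_segment e S i : (e.+2 <= size D)%N -> segment_at D e S ->
  prefix_weight D (e + nat_of_bool i) =
  prefix_weight D e + (if i then weight (nth letter0 S 0) else 0).
Proof.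
move=> eD seg; have := seg 0%N isT; rewrite addn0 => n0.
by case: i; rewrite ?addn0 ?addr0 // addn1 prefix_weightS ?n0 // ltnW.
Qed.

(** Everything is expressed through prefix sums at the three bases, which the move preserves and
    which telescope. What remains is a finite check on signs. *)
Lemma triangle_ind :
  [/\ ind D a = prefix_weight D b2 - prefix_weight D b1 +
        ((if f2 then 0 else - wsign p23) - (if f1 then 0 else - wsign p13) + wsign p12),
      ind D b = prefix_weight D b3 - prefix_weight D b1 +
        ((if f3 then 0 else wsign p23) - (if f1 then - wsign p12 else 0) + wsign p13) &
      ind D c = prefix_weight D b3 - prefix_weight D b2 +
        ((if f3 then wsign p13 else 0) - (if f2 then wsign p12 else 0) + wsign p23)].
Proof.
have [[aD bD cD] [[as_ bs_ cs_] [[at_ bt ct] [ah bh ch]]]] := triangle_letters.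
rewrite !indE // as_ bs_ cs_ at_ bt ct ah bh ch.
rewrite !(prefix_segment _ b1_le seg1) !(prefix_segment _ b2_le seg2) !(prefix_segment _ b3_le seg3).
by split; case: (f1); case: (f2); case: (f3); rewrite /weight /=; ring.
Qed.

Hypothesis apart12 : apart b1 b2.

Lemma triangle_uniq : uniq [:: a; b; c].
Proof.
have [_ [_ [[at_ bt ct] [_ bh ch]]]] := triangle_letters.
rewrite /= !inE negb_or andbT -andbA; apply/and3P; split; apply/negP => /eqP E.
- by move: at_; rewrite E bt; case: (f1); lia.
- by move: at_ apart12; rewrite E ct /apart; case: (f1); case: (f2); lia.
- by move: bh; rewrite E ch; case: (f3); lia.
Qed.

Lemma triangle_labels :
  perm_eq (labels D) ([seq z <- labels D | z \notin [:: a; b; c]] ++ [:: a; b; c]).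
Proof.
have [[aD bD cD] _] := triangle_letters.
rewrite -(perm_filterC (mem [:: a; b; c]) (labels D)) perm_catC.
apply: perm_cat => //; apply: uniq_perm; rewrite ?filter_uniq ?labels_uniq ?triangle_uniq //.
move=> z; rewrite mem_filter /= !inE andb_idr //.
by case/or3P=> /eqP ->.
Qed.

Lemma triangle_outer z o : z \in labels D -> z \notin [:: a; b; c] ->
  all (fun e => (pos D z o != e) && (pos D z o != e.+1)) [:: b1; b2; b3].
Proof.
move=> zD zabc; have zP := nth_pos wfD o zD.
have out e S : segment_at D e S -> (forall i, (i < 2)%N -> lab (nth letter0 S i) \in [:: a; b; c]) ->
    (pos D z o != e) && (pos D z o != e.+1).
  move=> seg Sabc; apply/andP; split; apply/eqP => E.
    by have := Sabc 0%N isT; rewrite -seg // addn0 -E zP; apply/negP.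
  by have := Sabc 1%N isT; rewrite -seg // addn1 -E zP; apply/negP.
rewrite /= (out _ _ seg1) ?(out _ _ seg2) ?(out _ _ seg3) //.
- by case=> [|[|]] //; case: (f3); rewrite /= !inE eqxx ?orbT.
- by case=> [|[|]] //; case: (f2); rewrite /= !inE eqxx ?orbT.
- by case=> [|[|]] //; case: (f1); rewrite /= !inE eqxx ?orbT.
Qed.

Lemma triangle_crossings n :
  [seq crossing_of n D z | z <- [:: a; b; c]] =
  map (emb_crossing (strand_arc [:: b1; b2; b3]))
    (triangle (smoothable n D a) (smoothable n D b) (smoothable n D c) p12 p13 p23 f1 f2 f3).
Proof.
have [_ [[as_ bs_ cs_] [[at_ bt ct] [ah bh ch]]]] := triangle_letters.
rewrite /= /crossing_of as_ bs_ cs_ at_ bt ct ah bh ch /emb_crossing /strand_arc.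
by case: (f1); case: (f2); case: (f3).
Qed.

End Triangle.

Variables (n : nat) (R : fieldType) (q : R).
Hypothesis q0 : q != 0.
Let A := q^-1.

Lemma triangle_Vjones D D' (b1 b2 b3 : nat) (f1 f2 f3 : bool) :
  p12 (+) (f1 (+) f2) = p23 (+) (f2 (+) f3) ->
  p12 (+) (f1 (+) f2) = p13 (+) (f1 (+) f3) ->
  gd_wf D -> gd_wf D' ->
  [&& apart b1 b2, apart b1 b3 & apart b2 b3] ->
  [&& b1.+2 <= size D, b2.+2 <= size D & b3.+2 <= size D]%N ->
  segment_at D b1 (strand1 f1) -> segment_at D' b1 (strand1 (~~ f1)) ->
  segment_at D b2 (strand2 f2) -> segment_at D' b2 (strand2 (~~ f2)) ->
  segment_at D b3 (strand3 f3) -> segment_at D' b3 (strand3 (~~ f3)) ->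
  agree_off [:: b1; b2; b3] D D' ->
  Vjones n D q = Vjones n D' q.
Proof.
move=> h1 h2 wfD wfD' /and3P[ap12 ap13 ap23] /and3P[b1D b2D b3D].
move=> s1 s1' s2 s2' s3 s3' [pD nD wD].
have sD : size D' = size D by rewrite (perm_size pD).
have [b1D' b2D' b3D'] : [/\ (b1.+2 <= size D')%N, (b2.+2 <= size D')%N & (b3.+2 <= size D')%N].
  by rewrite sD.
have pE := perm_labels pD.
have [L [[as_ bs_ cs_] _]] := triangle_letters wfD b1D b2D b3D s1 s2 s3.
have [L' [[as' bs' cs'] _]] := triangle_letters wfD' b1D' b2D' b3D' s1' s2' s3'.
have outer z : z \in labels D -> z \notin [:: a; b; c] ->
    (forall o, pos D' z o = pos D z o) /\ sgnof D' z = sgnof D z.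
  move=> zD zabc.
  have at_ o : nth letter0 D' (pos D z o) = ((z, o), sgnof D z).
    by rewrite -nD ?nth_pos // (triangle_outer wfD s1 s2 s3).
  have F o : [/\ z \in labels D', pos D' z o = pos D z o & sgnof D' z = sgnof D z].
    by apply: nth_letter => //; rewrite sD pos_lt.
  by split=> [o|]; [case: (F o)|case: (F true)].
have wB e : e \in [:: b1; b2; b3] -> prefix_weight D' e = prefix_weight D e.
  move=> eb; rewrite wD //; apply/allP => e' e'b.
  move: ap12 ap13 ap23 eb e'b; clear; rewrite /apart !inE.
  by move=> ? ? ? /or3P[] /eqP -> /or3P[] /eqP ->; lia.
have [ia ib ic] := triangle_ind wfD b1D b2D b3D s1 s2 s3.
have := triangle_ind wfD' b1D' b2D' b3D' s1' s2' s3'.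
rewrite !wB ?inE ?eqxx ?orbT // => -[ia' ib' ic'].
(* Both the invariance of the three indices and their additivity rest on realizability, which ties
   the signs to the orders along the strands. *)
have E23 : p23 = p12 (+) f1 (+) f3 by move: h1; case: (p12) (p23) (f1) (f2) (f3) => [] [] [] [] [].
have E13 : p13 = p12 (+) f2 (+) f3 by move: h2; case: (p12) (p13) (f1) (f2) (f3) => [] [] [] [] [].
have [eqa eqb eqc ibac] : [/\ ind D' a = ind D a, ind D' b = ind D b, ind D' c = ind D c &
    ind D b = ind D a + ind D c].
  rewrite ia ib ic ia' ib' ic' E13 E23.
  by split; case: (p12); case: (f1); case: (f2); case: (f3); rewrite /=; ring.
have indE' z : z \in labels D -> ind D' z = ind D z.
  move=> zD; have [|zabc] := boolP (z \in [:: a; b; c]).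
    by rewrite !inE => /or3P[] /eqP ->.
  have [pz sz] := outer z zD zabc.
  have zD' : z \in labels D' by rewrite (perm_mem pE).
  rewrite !indE // !pz sz -!wD //; have := triangle_outer wfD s1 s2 s3 _ zD zabc.
    by move=> /(_ true); apply: sub_all => e /andP[].
  by move=> /(_ false); apply: sub_all => e /andP[].
have sgnE z : z \in labels D -> sgnof D' z = sgnof D z.
  move=> zD; have [|zabc] := boolP (z \in [:: a; b; c]); last by have [] := outer z zD zabc.
  by rewrite !inE => /or3P[] /eqP ->; rewrite ?as_ ?as' ?bs_ ?bs' ?cs_ ?cs'.
have wr : writhe D' = writhe D.
  by rewrite /writhe (perm_big _ pE); apply: eq_big_seq => z zD; rewrite sgnE.
rewrite /Vjones -/A wr; congr (_ * _).
have A0 : A != 0 by apply: A_neq0.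
rewrite !bracketE // sD.
set ext := [seq z <- labels D | z \notin [:: a; b; c]].
have F_perm : perm_invariant (loop_value A (size D)) by apply: loop_value_perm.
have pl := triangle_labels wfD b1D b2D b3D s1 s2 s3 ap12.
rewrite (state_sum_perm A F_perm (perm_map (crossing_of n D) pl)).
rewrite (state_sum_perm A F_perm (perm_map (crossing_of n D') (perm_trans pE pl))).
rewrite !map_cat (triangle_crossings wfD b1D b2D b3D s1 s2 s3).
rewrite (triangle_crossings wfD' b1D' b2D' b3D' s1' s2' s3').
rewrite /smoothable eqa eqb eqc -/(smoothable n D a) -/(smoothable n D b) -/(smoothable n D c).
rewrite -/ext.
have -> : map (crossing_of n D') ext = map (crossing_of n D) ext.
  apply/eq_in_map => z; rewrite mem_filter => /andP[zabc zD].
  have [pz sz] := outer z zD zabc.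
  by rewrite /crossing_of /smoothable indE' // sz !pz.
set loc := triangle _ _ _ _ _ _ f1 _ _; set loc' := triangle _ _ _ _ _ _ (~~ f1) _ _.
rewrite (@state_sum_local _ A (size D) [:: b1; b2; b3] _ _ _ [:: 1; 4; 7]%N
   (map (crossing_of n D) ext) loc loc' 1) ?mul1r //.
- move: ap12 ap13 ap23; rewrite /apart /= !inE; clear; lia.
- by move=> e; rewrite !inE => /or3P[] /eqP ->.
- move=> e e'; move: ap12 ap13 ap23; clear; rewrite /apart !inE.
  by move=> ? ? ? /or3P[] /eqP -> /or3P[] /eqP ->; lia.
- rewrite all_map; apply/allP => z; rewrite mem_filter => /andP[zabc zD] /=.
  rewrite !pos_lt // /avoids.
  have := triangle_outer wfD s1 s2 s3 true zD zabc.
  by have := triangle_outer wfD s1 s2 s3 false zD zabc => /= -> ->.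
- by rewrite /loc /loc' /triangle /=; case: (f1); case: (f2); case: (f3).
- move=> X; rewrite mul1r; apply: tangle_sum_triangle => //.
  (* If two of [ind a], [ind c] and their sum are multiples of [n], so is the third. *)
  rewrite /smoothable ibac -andbA.
  apply/and3P; split; apply/implyP => /andP[d1 d2].
  + by rewrite -(rpredDl _ d1).
  + exact: rpredD.
  + by rewrite -(rpredDr _ d2).
- by rewrite /outer_edges /= leqnn /= (gtn_eqF b1D) (gtn_eqF b2D) (gtn_eqF b3D).
Qed.

(** The base point may meet the top, middle and bottom strands in any of six orders. *)
Lemma perm_eq3 (T : eqType) (x y z x' y' z' : T) :
  perm_eq [:: x; y; z] [:: x'; y'; z'] ->
  [\/ [/\ x = x', y = y' & z = z'], [/\ x = x', y = z' & z = y'],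
      [/\ x = y', y = x' & z = z'] | [/\ x = y', y = z' & z = x']] \/
  [/\ x = z', y = x' & z = y'] \/ [/\ x = z', y = y' & z = x'].
Proof.
have perm2 (t u t' u' : T) : perm_eq [:: t; u] [:: t'; u'] ->
    t = t' /\ u = u' \/ t = u' /\ u = t'.
  move=> ptu; have := perm_mem ptu t; rewrite !inE eqxx => /esym/orP[] /eqP E.
    by left; move: ptu; rewrite E perm_cons => /perm_mem/(_ u); rewrite !inE eqxx => /esym/eqP.
  right; move: ptu; rewrite E -[[:: t'; u']]/([:: t'] ++ [:: u']) perm_sym perm_catC perm_sym /=.
  by rewrite perm_cons => /perm_mem/(_ u); rewrite !inE eqxx => /esym/eqP.
move=> pxyz; have := perm_mem pxyz x; rewrite !inE eqxx => /esym/or3P[] /eqP E.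
- by move: pxyz; rewrite E perm_cons => /perm2[] [-> ->]; left; [constructor 1|constructor 2].
- move: pxyz; rewrite E perm_sym (perm_catCA [:: x'] [:: y'] [:: z']) perm_sym perm_cons.
  by move=> /perm2[] [-> ->]; left; [constructor 3|constructor 4].
move: pxyz; rewrite E perm_sym (perm_catC [:: x'; y'] [:: z']) perm_sym perm_cons.
by move=> /perm2[] [-> ->]; right; [left|right].
Qed.

End Omega3Letters.

Lemma omega3_Vjones n (R : fieldType) (q : R) D D' : q != 0 ->
  gd_wf D -> gd_wf D' -> omega3 D D' -> Vjones n D q = Vjones n D' q.
Proof.
move=> q0 wfD wfD' [u1 [u2 [u3 [u4 [X [Y [Z [segs [DE D'E]]]]]]]]].
case: segs => a [b [c [p12 [p13 [p23 [f1 [f2 [f3 [h1 [h2 pXYZ]]]]]]]]]].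
move: pXYZ; rewrite -/(strand1 a b p12 p13 f1) -/(strand2 a c p12 p23 f2) -/(strand3 b c p13 p23 f3).
set S1 := strand1 _ _ _ _ _; set S2 := strand2 _ _ _ _ _; set S3 := strand3 _ _ _ _ _ => pXYZ.
have r1 : rev S1 = strand1 a b p12 p13 (~~ f1) by rewrite /S1 /strand1; case: (f1).
have r2 : rev S2 = strand2 a c p12 p23 (~~ f2) by rewrite /S2 /strand2; case: (f2).
have r3 : rev S3 = strand3 b c p13 p23 (~~ f3) by rewrite /S3 /strand3; case: (f3).
have size_seg W : W \in [:: X; Y; Z] -> size W = 2.
  rewrite (perm_mem pXYZ) !inE /S1 /S2 /S3 /strand1 /strand2 /strand3.
  by case/or3P=> /eqP ->; case: ifP.
have sX : size X = 2 by rewrite size_seg ?inE ?eqxx ?orbT.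
have sY : size Y = 2 by rewrite size_seg ?inE ?eqxx ?orbT.
have sZ : size Z = 2 by rewrite size_seg ?inE ?eqxx ?orbT.
pose vY W := u1 ++ W ++ u2; pose vZ W W' := vY W ++ W' ++ u3.
pose bX := size u1; pose bY := size (vY X); pose bZ := size (vZ X Y).
have bY' : size (vY (rev X)) = bY by rewrite /bY /vY !size_cat size_rev.
have bZ' : size (vZ (rev X) (rev Y)) = bZ by rewrite /bZ /vZ !size_cat !size_rev.
have bYE : bY = (bX + 2 + size u2)%N by rewrite /bY /vY !size_cat sX addnA.
have bZE : bZ = (bY + 2 + size u3)%N by rewrite /bZ /vZ !size_cat sY /bY /vY !size_cat !addnA.
have sD : size D = (bZ + 2 + size u4)%N.
  by rewrite DE /bZ /vZ /vY !size_cat sX sY sZ !addnA.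
have /and3P[apXY apXZ apYZ] : [&& apart bX bY, apart bX bZ & apart bY bZ].
  by rewrite /apart; clear -bYE bZE; clearbody bX bY bZ; lia.
have /and3P[leX leY leZ] : [&& bX.+2 <= size D, bY.+2 <= size D & bZ.+2 <= size D]%N.
  by clear -bYE bZE sD; clearbody bX bY bZ; lia.
have apC e e' : apart e e' = apart e' e by rewrite /apart orbC.
have seg u w v : size w = 2 -> segment_at (u ++ w ++ v) (size u) w.
  by move=> sw i i2; rewrite nth_infix ?sw.
have segX : segment_at D bX X by rewrite DE; apply: seg.
have segX' : segment_at D' bX (rev X) by rewrite D'E; apply: seg; rewrite size_rev.
have segY : segment_at D bY Y.
  have -> : D = vY X ++ Y ++ (u3 ++ Z ++ u4) by rewrite DE /vY -!catA.
  exact: seg.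
have segY' : segment_at D' bY (rev Y).
  have -> : D' = vY (rev X) ++ rev Y ++ (u3 ++ rev Z ++ u4) by rewrite D'E /vY -!catA.
  by rewrite -bY'; apply: seg; rewrite size_rev.
have segZ : segment_at D bZ Z.
  have -> : D = vZ X Y ++ Z ++ u4 by rewrite DE /vZ /vY -!catA.
  exact: seg.
have segZ' : segment_at D' bZ (rev Z).
  have -> : D' = vZ (rev X) (rev Y) ++ rev Z ++ u4 by rewrite D'E /vZ /vY -!catA.
  by rewrite -bZ'; apply: seg; rewrite size_rev.
(* The segments are reversed one at a time; since reversal keeps sizes, the bases do not move. *)
have off : agree_off [:: bX; bY; bZ] D D'.
  apply: (@agree_off_trans [:: bX] [:: bY; bZ] _ (u1 ++ rev X ++ u2 ++ Y ++ u3 ++ Z ++ u4)).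
    by rewrite DE; apply: agree_off_rev.
  apply: (@agree_off_trans [:: bY] [:: bZ] _ (u1 ++ rev X ++ u2 ++ rev Y ++ u3 ++ Z ++ u4)).
    by have := agree_off_rev (vY (rev X)) (u3 ++ Z ++ u4) sY; rewrite bY' /vY -!catA.
  by have := agree_off_rev (vZ (rev X) (rev Y)) u4 sZ; rewrite bZ' D'E /vZ /vY -!catA.
have concl b1 b2 b3 : segment_at D b1 S1 -> segment_at D' b1 (rev S1) ->
    segment_at D b2 S2 -> segment_at D' b2 (rev S2) ->
    segment_at D b3 S3 -> segment_at D' b3 (rev S3) ->
    perm_eq [:: bX; bY; bZ] [:: b1; b2; b3] -> Vjones n D q = Vjones n D' q.
  rewrite r1 r2 r3 => s1 s1' s2 s2' s3 s3' pb.
  have bE e : e \in [:: b1; b2; b3] -> (e.+2 <= size D)%N.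
    by rewrite -(perm_mem pb) !inE => /or3P[] /eqP ->.
  apply: (triangle_Vjones n q0 h1 h2 wfD wfD' _ _ s1 s1' s2 s2' s3 s3').
  - move: (perm_eq3 pb) apXY apXZ apYZ; clear -apC.
    by case=> [[] | []] [-> -> ->] h h' h''; apply/and3P; split; rewrite // apC.
  - by rewrite !bE ?inE ?eqxx ?orbT.
  - by apply: agree_off_sub off => e; rewrite (perm_mem pb).
case: (perm_eq3 pXYZ) => [[] | []] [XE YE ZE]; rewrite XE YE ZE in segX segX' segY segY' segZ segZ'.
- by apply: (concl bX bY bZ).
- by apply: (concl bX bZ bY) => //; apply/permP => P /=; clear; lia.
- by apply: (concl bY bX bZ) => //; apply/permP => P /=; clear; lia.
- by apply: (concl bZ bX bY) => //; apply/permP => P /=; clear; lia.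
- by apply: (concl bY bZ bX) => //; apply/permP => P /=; clear; lia.
- by apply: (concl bZ bY bX) => //; apply/permP => P /=; clear; lia.
Qed.

(** * Change of base point and of the names of crossings *)

Lemma gd_wf_perm D D' : perm_eq D D' -> gd_wf D -> gd_wf D'.
Proof.
move=> pD /andP[uD aD]; apply/andP; split.
  by rewrite -(perm_uniq (perm_map (fun l => (lab l, ovr l)) pD)).
rewrite -(perm_all _ pD); apply: sub_all aD => l.
by rewrite (perm_mem pD).
Qed.

Section BasePoint.
Variable N : nat.

Definition rot_pos (p : nat) : nat := if p == 0%N then N.-1 else p.-1.
Definition unrot_pos (p : nat) : nat := if p == N then 1%N else p.+1.

(** The equality of colours at [0] and [N] has to be carried along: at the letter moved to the end,
    the outgoing arc is [(rot_pos 0).+1 = N], whereas [rot_pos 1 = 0]. *)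
Definition rotated (E E' : seq edge) : Prop :=
  (forall f : {ffun 'I_N.+1 -> bool}, compat E f ->
     f (inord 0) = f (inord N) /\ compat E' [ffun i : 'I_N.+1 => f (inord (unrot_pos i))]) /\
  (forall f : {ffun 'I_N.+1 -> bool}, compat E' f ->
     f (inord 0) = f (inord N) /\ compat E [ffun i : 'I_N.+1 => f (inord (rot_pos i))]).

Hypothesis N0 : (0 < N)%N.

Lemma rot_pos_le p : (p <= N)%N -> (rot_pos p <= N)%N.
Proof. by rewrite /rot_pos; case: eqP; lia. Qed.

Lemma unrot_pos_le p : (p <= N)%N -> (unrot_pos p <= N)%N.
Proof. by rewrite /unrot_pos; case: eqP; lia. Qed.

Lemma unrot_rot (f : {ffun 'I_N.+1 -> bool}) p : (p <= N)%N -> f (inord 0) = f (inord N) ->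
  f (inord (unrot_pos (rot_pos p))) = f (inord p).
Proof.
move=> pN f0; rewrite /rot_pos /unrot_pos; case: (p =P 0%N) => [->|p0].
  by rewrite ltn_eqF ?prednK // ltn_predL.
by rewrite ltn_eqF ?prednK //; lia.
Qed.

Lemma rot_unrot (f : {ffun 'I_N.+1 -> bool}) p : (p <= N)%N -> f (inord 0) = f (inord N) ->
  f (inord (rot_pos (unrot_pos p))) = f (inord p).
Proof. by move=> pN f0; rewrite /rot_pos /unrot_pos; case: (p =P N) => [->|_]. Qed.

Lemma rotated_closure : rotated [:: (0, N)%N] [:: (0, N)%N].
Proof.
split=> f /andP[/eqP f0 _]; split=> //=; rewrite andbT !ffunE !inordK //.
  rewrite /unrot_pos eqxx if_same; exact: eqxx.
rewrite /rot_pos eqxx (_ : (N == 0%N) = false); [exact: eqxx|by apply/negbTE; rewrite -lt0n].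
Qed.

Lemma comps_rotated E E' : rotated E E' -> comps N E = comps N E'.
Proof.
case=> rot unrot; congr trunc_log.
have le (i : 'I_N.+1) : (i <= N)%N by rewrite -ltnS.
apply: (@ncol_transfer _ _ _ _ (fun i => inord (unrot_pos i)) (fun i => inord (rot_pos i)))
  => [f i /rot[f0 _]|f i /unrot[f0 _]|f /rot[]|f /unrot[]] //.
- by rewrite inordK ?ltnS ?rot_pos_le // unrot_rot // inord_val.
- by rewrite inordK ?ltnS ?unrot_pos_le // rot_unrot // inord_val.
Qed.

Lemma rotated_smoothing k t h E E' : (t < N)%N -> (h < N)%N -> rotated E E' ->
  rotated (smoothing k (t, h) ++ E) (smoothing k (rot_pos t, rot_pos h) ++ E').
Proof.
move=> tN hN [rot unrot]; split=> f; rewrite compat_cat => /andP[fs fE].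
  have [f0 fE'] := rot f fE; split=> //; rewrite compat_cat fE' andbT.
  pose g := [ffun i : 'I_N.+1 => f (inord (unrot_pos i))].
  have gE p : (p < N)%N -> (g (inord (rot_pos p)) = f (inord p)) *
                           (g (inord (rot_pos p).+1) = f (inord p.+1)).
    move=> pN; split; rewrite ffunE.
      by rewrite inordK ?ltnS ?rot_pos_le ?unrot_rot // ltnW.
    rewrite /rot_pos /unrot_pos; case: (p =P 0%N) => [->|p0].
      by rewrite prednK // inordK // eqxx.
    by rewrite prednK; [rewrite inordK ?ltn_eqF // ltnW|lia].
  by move: fs; rewrite /smoothing -/g; case: k => [[]|] /=; rewrite !gE.
have [f0 fE'] := unrot f fE; split=> //; rewrite compat_cat fE' andbT.
pose g := [ffun i : 'I_N.+1 => f (inord (rot_pos i))].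
have gE p : (p < N)%N -> (g (inord p) = f (inord (rot_pos p))) *
                         (g (inord p.+1) = f (inord (rot_pos p).+1)).
  move=> pN; split; rewrite ffunE inordK ?ltnS //; first exact: ltnW.
  rewrite /rot_pos /=; case: (p =P 0%N) => [->|p0]; first by rewrite prednK.
  by rewrite prednK //; lia.
by move: fs; rewrite /smoothing -/g; case: k => [[]|] /=; rewrite !(gE t tN) !(gE h hN).
Qed.

End BasePoint.

Lemma rot1_Vjones n (R : fieldType) (q : R) l E : q != 0 ->
  gd_wf (l :: E) -> Vjones n (l :: E) q = Vjones n (rcons E l) q.
Proof.
move=> q0; set D := l :: E; set D' := rcons E l => wfD.
have pD : perm_eq D D' by rewrite /D /D' perm_sym perm_rcons.
have wfD' := gd_wf_perm pD wfD; have pL := perm_labels pD.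
pose N := size D; have sD' : size D' = N by rewrite -(perm_size pD).
have N0 : (0 < N)%N by [].
have nthE p : (p < N)%N -> nth letter0 D' (rot_pos N p) = nth letter0 D p.
  case: p => [|p] pN; rewrite /rot_pos /D' nth_rcons /=; first by rewrite ltnn eqxx.
  by rewrite (_ : (p < size E)%N).
(* All prefix sums drop by the same amount, which cancels in the indices; for the moved letter this
   uses that the total weight is zero. *)
have prefE p : (p < N)%N -> prefix_weight D' (rot_pos N p) = prefix_weight D p - weight l.
  case: p => [|p] pN; rewrite /rot_pos /prefix_weight /=.
    rewrite /D' -cats1 take_size_cat // big_nil sub0r.
    have := prefix_weight_size wfD; rewrite /prefix_weight take_size big_cons => /eqP.
    by rewrite addrC addr_eq0 => /eqP.
  rewrite big_cons addrC addKr /D' -cats1 take_cat; case: ltnP => // Ep.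
  have -> : p = size E by move: pN; rewrite /N /=; lia.
  by rewrite subnn cats0 take_size.
have letters z o : z \in labels D ->
    [/\ z \in labels D', pos D' z o = rot_pos N (pos D z o) & sgnof D' z = sgnof D z].
  move=> zD; apply: nth_letter => //; last by rewrite nthE ?pos_lt // nth_pos.
  by rewrite sD'; have := pos_lt wfD o zD; rewrite -/N /rot_pos; case: eqP; lia.
have indE' z : z \in labels D -> ind D' z = ind D z.
  move=> zD; have [zD' pt sg] := letters z true zD; have [_ ph _] := letters z false zD.
  by rewrite !indE // pt ph sg !prefE ?pos_lt //; ring.
have wr : writhe D' = writhe D.
  rewrite /writhe (perm_big _ pL); apply: eq_big_seq => z zD.
  by have [_ _ ->] := letters z true zD.
rewrite /Vjones wr; congr (_ * _); have A0 := A_neq0 q0.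
rewrite !bracketE // sD' -/N.
rewrite (state_sum_perm _ (@loop_value_perm _ _ N) (perm_map (crossing_of n D') pL)).
pose g (c : crossing) : crossing := (c.1, (rot_pos N c.2.1, rot_pos N c.2.2)).
have -> : map (crossing_of n D') (labels D) = map g (map (crossing_of n D) (labels D)).
  rewrite -map_comp; apply/eq_in_map => z zD.
  have [zD' pt sg] := letters z true zD; have [_ ph _] := letters z false zD.
  by rewrite /= /crossing_of /g /smoothable indE' // sg pt ph.
apply: esym; rewrite -[RHS]mul1r; apply: (@state_sum_rel _ _ (rotated N)) => //.
- by move=> E1 E1' r; rewrite mul1r /loop_value (comps_rotated N0 r).
- move=> c k E1 E1' /mapP[z zD ->] r.
  by apply: rotated_smoothing => //; apply: pos_lt.
- exact: rotated_closure.
Qed.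

Lemma rotation_Vjones n (R : fieldType) (q : R) D D' : q != 0 ->
  gd_wf D -> rotation D D' -> Vjones n D q = Vjones n D' q.
Proof.
move=> q0 wfD [k ->]; elim: k => [|k IH]; first by rewrite rot0.
have [kD|Dk] := ltnP k (size D); last by rewrite rot_oversize // ltnW.
rewrite rotS // IH; have wfk : gd_wf (rot k D).
  by apply: gd_wf_perm wfD; rewrite perm_sym perm_rot.
by case: (rot k D) wfk => [|l E] wfE //; rewrite rot1_cons; apply: rot1_Vjones.
Qed.

Lemma relabel_Vjones n (R : fieldType) (q : R) D D' : q != 0 ->
  gd_wf D -> gd_wf D' -> relabel D D' -> Vjones n D q = Vjones n D' q.
Proof.
move=> q0 wfD wfD' [f [f_inj D'E]].
pose F (l : letter) : letter := ((f (lab l), ovr l), sgn l).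
have labE : labels D' = map f (labels D).
  by rewrite /labels -(undup_map_inj f_inj) D'E -map_comp -[in RHS]map_comp.
have sD' : size D' = size D by rewrite D'E size_map.
have letters z o : z \in labels D ->
    [/\ f z \in labels D', pos D' (f z) o = pos D z o & sgnof D' (f z) = sgnof D z].
  move=> zD; apply: nth_letter; rewrite ?sD' ?pos_lt //.
  by rewrite D'E (nth_map letter0) ?pos_lt // nth_pos.
have prefE p : prefix_weight D' p = prefix_weight D p.
  by rewrite /prefix_weight D'E -map_take big_map.
have indE' z : z \in labels D -> ind D' (f z) = ind D z.
  move=> zD; have [zD' pt sg] := letters z true zD; have [_ ph _] := letters z false zD.
  by rewrite !indE // pt ph sg !prefE.
have wr : writhe D' = writhe D.
  rewrite /writhe labE big_map; apply: eq_big_seq => z zD.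
  by have [_ _ ->] := letters z true zD.
rewrite /Vjones wr; congr (_ * _); have A0 := A_neq0 q0.
rewrite !bracketE // sD' labE -map_comp; congr (state_sum _ _ _ _).
apply/eq_in_map => z zD.
have [zD' pt sg] := letters z true zD; have [_ ph _] := letters z false zD.
by rewrite /= /crossing_of /smoothable indE' // sg pt ph.
Qed.

Theorem theorem4p1 (n : nat) (R : fieldType) (q : R) (D D' : gword) :
  q != 0 -> gd_wf D -> gd_wf D' -> rmove D D' ->
  Vjones n D q = Vjones n D' q.
Proof.
move=> q0; suff step D1 D2 : gd_wf D1 -> gd_wf D2 -> rstep D1 D2 ->
    Vjones n D1 q = Vjones n D2 q.
  by move=> wfD wfD' [|/step E]; [apply: step|rewrite E].
move=> wf1 wf2 [|[|[|[|]]]].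
- exact: omega1_Vjones.
- exact: omega2_Vjones.
- exact: omega3_Vjones.
- exact: rotation_Vjones.
- exact: relabel_Vjones.
Qed.
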